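(* The functor $\mathbb{H}:\mathbf{Cat}\to\mathbf{DblCat}$ preserves and reflects weak equivalences, fibrations, and cofibrations: a functor $F$ is a weak equivalence (respectively fibration, respectively cofibration) in the categorical model structure on $\mathbf{Cat}$ if and only if $\mathbb{H}F$ is a weak equivalence (respectively fibration, respectively cofibration) in the trivial model structure on $\mathbf{DblCat}$ that arises from the 2-category $\mathbf{DblCat_h}$. As a consequence, the trivial model structure on $\mathbf{DblCat}$ from $\mathbf{DblCat_h}$ extends the categorical model structure on $\mathbf{Cat}$ as a horizontally embedded subcategory.
   Context: A small double category is an internal category $\mathbb{D}=(\mathbb{D}_0,\mathbb{D}_1)$ in $\mathbf{Cat}$: $\mathbb{D}_0$ is the category of objects and vertical morphisms, $\mathbb{D}_1$ the category of horizontal morphisms and squares. $\mathbf{DblCat}$ is the category of small double categories and double functors (internal functors), and $\mathbf{DblCat_h}=\mathsf{Cat}(\mathbf{Cat})$ is the 2-category with 2-cells the horizontal natural transformations, i.e. the internal natural transformations in $\mathbf{Cat}$. The horizontal embedding $\mathbb{H}:\mathbf{Cat}\to\mathbf{DblCat}$ regards a category as a double category with discrete $\mathbb{D}_0$ and $\mathbb{D}_1$ (objects and morphisms of the category become objects and horizontal morphisms; only trivial vertical morphisms and squares). The categorical model structure on $\mathbf{Cat}$ has weak equivalences the equivalences of categories, fibrations the isofibrations (functors $F:\mathbf{A}\to\mathbf{B}$ such that every isomorphism $b\cong Fa$ in $\mathbf{B}$ lifts to an isomorphism $a'\cong a$ in $\mathbf{A}$), and cofibrations the functors injective on objects. Trivial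 model structure (Lack): on the underlying category of a 2-category $\mathcal{K}$ with finite limits and finite colimits there is a model structure in which $f:A\to B$ is a weak equivalence (respectively fibration) if and only if for every object $E$ the functor $\mathcal{K}(E,f):\mathcal{K}(E,A)\to\mathcal{K}(E,B)$ is an equivalence of categories (respectively an isofibration). Equivalently, weak equivalences are the equivalences in $\mathcal{K}$, and $f$ is a fibration if and only if for all $a:E\to A$, $b:E\to B$ and invertible 2-cells $\beta:b\cong fa$ there are $a':E\to A$ and an invertible 2-cell $\alpha:a'\cong a$ with $fa'=b$, $f\alpha=\beta$. Cofibrations are the morphisms with the left lifting property against acyclic fibrations. Here $\mathcal{K}=\mathbf{DblCat_h}$. *)

(* Defs.v *)
From Stdlib Require Import ssreflect ProofIrrelevance FunctionalExtensionality.

Set Implicit Arguments.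
Unset Strict Implicit.
Unset Printing Implicit Defensive.
Set Primitive Projections.

(** Small categories are presented with a type of objects and a single type of
    morphisms, so that strict equalities of functors, pullbacks of categories
    and internal categories can be expressed without transport along equalities
    of objects.  Sets of objects and morphisms are types with Leibniz equality;
    by proof irrelevance, [cmp g f p] does not depend on [p]. *)
Record Category := {
  Ob : Type;
  Ar : Type;
  dom : Ar -> Ob;
  cod : Ar -> Ob;
  idn : Ob -> Ar;
  cmp : forall g f : Ar, dom g = cod f -> Ar;
  dom_idn : forall x, dom (idn x) = x;
  cod_idn : forall x, cod (idn x) = x;
  dom_cmp : forall g f p, dom (@cmp g f p) = dom f;
  cod_cmp : forall g f p, cod (@cmp g f p) = cod g;
  cmp_idl : forall f p, @cmp (idn (cod f)) f p = f;
  cmp_idr : forall f p, @cmp f (idn (dom f)) p = f;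
  cmp_assoc : forall h g f p q p' q',
    @cmp h (@cmp g f p) q = @cmp (@cmp h g p') f q'
}.
Arguments idn {c} _.
Arguments dom {c} _.
Arguments cod {c} _.
Arguments cmp {c} g f _.

Record Functor (A B : Category) := {
  F_ob : Ob A -> Ob B;
  F_ar : Ar A -> Ar B;
  F_dom : forall f, dom (F_ar f) = F_ob (dom f);
  F_cod : forall f, cod (F_ar f) = F_ob (cod f);
  F_idn : forall x, F_ar (idn x) = idn (F_ob x);
  F_cmp : forall g f p q, F_ar (cmp g f p) = cmp (F_ar g) (F_ar f) q
}.

Arguments F_cmp {A B} _ {g f} p q.

Lemma functor_ext (A B : Category) (F G : Functor A B) :
  (forall x, F_ob F x = F_ob G x) -> (forall f, F_ar F f = F_ar G f) -> F = G.
Proof.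
case: F => fo fa ? ? ? ?; case: G => go ga ? ? ? ? /= eo ea.
have ? : fo = go by apply: functional_extensionality.
have ? : fa = ga by apply: functional_extensionality.
subst; f_equal; apply: proof_irrelevance.
Qed.

Lemma cmp_congr (A : Category) (g g' f f' : Ar A) p p' :
  g = g' -> f = f' -> cmp g f p = cmp g' f' p'.
Proof. by move=> eg ef; subst; f_equal; apply: proof_irrelevance. Qed.

Definition fid (A : Category) : Functor A A.
Proof.
refine {| F_ob := fun x => x; F_ar := fun f => f |} => //.
by move=> *; apply: cmp_congr.
Defined.

Definition fcomp (A B C : Category) (G : Functor B C) (F : Functor A B) :
  Functor A C.
Proof.
refine {| F_ob := fun x => F_ob G (F_ob F x); F_ar := fun f => F_ar G (F_ar F f) |}.
- by move=> f; rewrite !F_dom.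
- by move=> f; rewrite !F_cod.
- by move=> x; rewrite !F_idn.
- move=> g f p q.
  have p' : dom (F_ar F g) = cod (F_ar F f) by rewrite F_dom F_cod p.
  by rewrite (F_cmp F p p') (F_cmp G p' q).
Defined.

Lemma fcompA (A B C D : Category) (H : Functor C D) (G : Functor B C)
  (F : Functor A B) : fcomp (fcomp H G) F = fcomp H (fcomp G F).
Proof. exact: functor_ext. Qed.

Lemma fcomp_idl (A B : Category) (F : Functor A B) : fcomp (fid B) F = F.
Proof. exact: functor_ext. Qed.

Lemma fcomp_idr (A B : Category) (F : Functor A B) : fcomp F (fid A) = F.
Proof. exact: functor_ext. Qed.

Definition is_iso (A : Category) (f : Ar A) : Prop :=
  exists (g : Ar A) (p : dom g = cod f) (q : dom f = cod g),
    cmp g f p = idn (dom f) /\ cmp f g q = idn (cod f).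

Definition nat_iso (A B : Category) (F G : Functor A B) : Prop :=
  exists (t : Ob A -> Ar B)
    (td : forall x, dom (t x) = F_ob F x) (tc : forall x, cod (t x) = F_ob G x),
    (forall x, is_iso (t x)) /\
    (forall f p q, cmp (F_ar G f) (t (dom f)) p = cmp (t (cod f)) (F_ar F f) q).

Definition equivalence (A B : Category) (F : Functor A B) : Prop :=
  exists G : Functor B A, nat_iso (fid A) (fcomp G F) /\ nat_iso (fcomp F G) (fid B).

Definition isofibration (A B : Category) (F : Functor A B) : Prop :=
  forall (a : Ob A) (b : Ar B), is_iso b -> cod b = F_ob F a ->
    exists al : Ar A, is_iso al /\ cod al = a /\ F_ar F al = b.

Definition injective_on_objects (A B : Category) (F : Functor A B) : Prop :=
  forall x y, F_ob F x = F_ob F y -> x = y.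

Definition discrete (T : Type) : Category.
Proof.
by refine {| Ob := T; Ar := T; dom := fun x => x; cod := fun x => x;
             idn := fun x => x; cmp := fun g f _ => f |}.
Defined.

Definition discrete_map (S T : Type) (h : S -> T) :
  Functor (discrete S) (discrete T).
Proof. by refine (@Build_Functor (discrete S) (discrete T) h h _ _ _ _). Defined.

Definition product (A B : Category) : Category.
Proof.
refine {| Ob := Ob A * Ob B; Ar := Ar A * Ar B;
  dom := fun f => (dom (fst f), dom (snd f));
  cod := fun f => (cod (fst f), cod (snd f));
  idn := fun x => (idn (fst x), idn (snd x));
  cmp := fun g f p => (cmp (fst g) (fst f) (f_equal fst p),
                       cmp (snd g) (snd f) (f_equal snd p)) |}.
- by case=> x y /=; rewrite !dom_idn.
- by case=> x y /=; rewrite !cod_idn.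
- by move=> g f p /=; rewrite !dom_cmp.
- by move=> g f p /=; rewrite !cod_cmp.
- by case=> x y p /=; rewrite !cmp_idl.
- by case=> x y p /=; rewrite !cmp_idr.
- by move=> h g f p q p' q' /=; congr pair; apply: cmp_assoc.
Defined.

Section Pullback.
Variables (A B C : Category) (F : Functor A C) (G : Functor B C).

Record pb_ob := { ob1 : Ob A; ob2 : Ob B; ob_eq : F_ob F ob1 = F_ob G ob2 }.
Record pb_ar := { ar1 : Ar A; ar2 : Ar B; ar_eq : F_ar F ar1 = F_ar G ar2 }.

Lemma pb_ob_ext (x y : pb_ob) : ob1 x = ob1 y -> ob2 x = ob2 y -> x = y.
Proof.
case: x y => [x1 x2 ex] [y1 y2 ey] /= e1 e2; subst.
by rewrite (proof_irrelevance _ ex ey).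
Qed.

Lemma pb_ar_ext (x y : pb_ar) : ar1 x = ar1 y -> ar2 x = ar2 y -> x = y.
Proof.
case: x y => [x1 x2 ex] [y1 y2 ey] /= e1 e2; subst.
by rewrite (proof_irrelevance _ ex ey).
Qed.

Lemma pb_dom_eq (f : pb_ar) : F_ob F (dom (ar1 f)) = F_ob G (dom (ar2 f)).
Proof. by rewrite -!F_dom ar_eq. Qed.

Lemma pb_cod_eq (f : pb_ar) : F_ob F (cod (ar1 f)) = F_ob G (cod (ar2 f)).
Proof. by rewrite -!F_cod ar_eq. Qed.

Lemma pb_idn_eq (x : pb_ob) : F_ar F (idn (ob1 x)) = F_ar G (idn (ob2 x)).
Proof. by rewrite !F_idn ob_eq. Qed.

Lemma pb_cmp_eq (g f : pb_ar) p1 p2 :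
  F_ar F (cmp (ar1 g) (ar1 f) p1) = F_ar G (cmp (ar2 g) (ar2 f) p2).
Proof.
have q1 : dom (F_ar F (ar1 g)) = cod (F_ar F (ar1 f)) by rewrite F_dom F_cod p1.
have q2 : dom (F_ar G (ar2 g)) = cod (F_ar G (ar2 f)) by rewrite F_dom F_cod p2.
by rewrite (F_cmp F p1 q1) (F_cmp G p2 q2); apply: cmp_congr; apply: ar_eq.
Qed.

Definition pb_dom (f : pb_ar) : pb_ob := Build_pb_ob (pb_dom_eq f).
Definition pb_cod (f : pb_ar) : pb_ob := Build_pb_ob (pb_cod_eq f).
Definition pb_idn (x : pb_ob) : pb_ar := Build_pb_ar (pb_idn_eq x).
Definition pb_cmp (g f : pb_ar) (p : pb_dom g = pb_cod f) : pb_ar :=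
  Build_pb_ar (pb_cmp_eq (f_equal ob1 p) (f_equal ob2 p)).

Definition pullback : Category.
Proof.
refine {| dom := pb_dom; cod := pb_cod; idn := pb_idn; cmp := pb_cmp |}.
- by move=> x; apply: pb_ob_ext; apply: dom_idn.
- by move=> x; apply: pb_ob_ext; apply: cod_idn.
- by move=> g f p; apply: pb_ob_ext; apply: dom_cmp.
- by move=> g f p; apply: pb_ob_ext; apply: cod_cmp.
- by move=> f p; apply: pb_ar_ext; apply: cmp_idl.
- by move=> f p; apply: pb_ar_ext; apply: cmp_idr.
- by move=> h g f p q p' q'; apply: pb_ar_ext; apply: cmp_assoc.
Defined.

Definition pb_fst : Functor pullback A.
Proof.
refine (@Build_Functor pullback A ob1 ar1 _ _ _ _) => //.
by move=> g f p q; apply: cmp_congr.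
Defined.

Definition pb_snd : Functor pullback B.
Proof.
refine (@Build_Functor pullback B ob2 ar2 _ _ _ _) => //.
by move=> g f p q; apply: cmp_congr.
Defined.

Lemma pb_sq : fcomp F pb_fst = fcomp G pb_snd.
Proof. by apply: functor_ext => [x|f]; [apply: ob_eq | apply: ar_eq]. Qed.

Definition pb_pair (X : Category) (U : Functor X A) (V : Functor X B)
  (e : fcomp F U = fcomp G V) : Functor X pullback.
Proof.
refine (@Build_Functor X pullback
  (fun x => Build_pb_ob (f_equal (fun K => F_ob K x) e : F_ob F _ = F_ob G _))
  (fun f => Build_pb_ar (f_equal (fun K => F_ar K f) e : F_ar F _ = F_ar G _))
  _ _ _ _).
- by move=> f; apply: pb_ob_ext; apply: F_dom.
- by move=> f; apply: pb_ob_ext; apply: F_cod.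
- by move=> x; apply: pb_ar_ext; apply: F_idn.
- by move=> g f p q; apply: pb_ar_ext; apply: F_cmp.
Defined.

Lemma pb_fst_pair X U V e : fcomp pb_fst (@pb_pair X U V e) = U.
Proof. exact: functor_ext. Qed.

Lemma pb_snd_pair X U V e : fcomp pb_snd (@pb_pair X U V e) = V.
Proof. exact: functor_ext. Qed.

Lemma pb_ext X (H K : Functor X pullback) :
  fcomp pb_fst H = fcomp pb_fst K -> fcomp pb_snd H = fcomp pb_snd K -> H = K.
Proof.
move=> e1 e2; apply: functor_ext => x.
- apply: pb_ob_ext.
  + exact: (f_equal (fun L => F_ob L x) e1).
  + exact: (f_equal (fun L => F_ob L x) e2).
- apply: pb_ar_ext.
  + exact: (f_equal (fun L => F_ar L x) e1).
  + exact: (f_equal (fun L => F_ar L x) e2).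
Qed.

Lemma pb_pair_pre X Y (U : Functor X A) (V : Functor X B) (W : Functor Y X)
    (e : fcomp F U = fcomp G V)
    (e' : fcomp F (fcomp U W) = fcomp G (fcomp V W)) :
  fcomp (pb_pair e) W = pb_pair e'.
Proof.
by apply: pb_ext; rewrite -fcompA ?pb_fst_pair ?pb_snd_pair.
Qed.

Lemma pb_pair_congr X (U U' : Functor X A) (V V' : Functor X B) 
    (e : fcomp F U = fcomp G V) (e' : fcomp F U' = fcomp G V') :
  U = U' -> V = V' -> pb_pair e = pb_pair e'.
Proof. by move=> eU eV; subst; congr pb_pair; apply: proof_irrelevance. Qed.

End Pullback.
Arguments pb_fst {A B C} F G.
Arguments pb_snd {A B C} F G.

(** [sF], [tF], [iF], [cF] are the source, target, identity and composition
    functors of an internal category in [Cat]; the composite [cF (g, f)] of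
    horizontal morphisms is [g] after [f].  The proofs [e] witness that the
    pairings make sense; they exist by the preceding fields. *)
Record DoubleCat := {
  D0 : Category;
  D1 : Category;
  sF : Functor D1 D0;
  tF : Functor D1 D0;
  iF : Functor D0 D1;
  cF : Functor (pullback sF tF) D1;
  d_si : fcomp sF iF = fid D0;
  d_ti : fcomp tF iF = fid D0;
  d_sc : fcomp sF cF = fcomp sF (pb_snd sF tF);
  d_tc : fcomp tF cF = fcomp tF (pb_fst sF tF);
  d_idl : forall e, fcomp cF (@pb_pair _ _ _ sF tF D1 (fcomp iF tF) (fid D1) e) = fid D1;
  d_idr : forall e, fcomp cF (@pb_pair _ _ _ sF tF D1 (fid D1) (fcomp iF sF) e) = fid D1;
  d_assoc :
    let T := pullback (fcomp sF (pb_snd sF tF)) tF in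
    let hg : Functor T (pullback sF tF) := pb_fst _ _ in
    let h : Functor T D1 := fcomp (pb_fst sF tF) hg in
    let g : Functor T D1 := fcomp (pb_snd sF tF) hg in
    let f : Functor T D1 := pb_snd _ _ in
    forall e1 e2 e3,
      fcomp cF (@pb_pair _ _ _ sF tF T (fcomp cF hg) f e1) =
      fcomp cF (@pb_pair _ _ _ sF tF T h (fcomp cF (@pb_pair _ _ _ sF tF T g f e2)) e3)
}.
Arguments sF {d}.
Arguments tF {d}.
Arguments iF {d}.
Arguments cF {d}.

(** Horizontal composition of generalized elements of [D1]. *)
Definition hc (D : DoubleCat) (X : Category) (U V : Functor X (D1 D))
  (e : fcomp sF U = fcomp tF V) : Functor X (D1 D) := fcomp cF (pb_pair e).
Arguments hc {D X} U V e.

Record DoubleFunctor (D E : DoubleCat) := {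
  DF0 : Functor (D0 D) (D0 E);
  DF1 : Functor (D1 D) (D1 E);
  DF_s : fcomp sF DF1 = fcomp DF0 sF;
  DF_t : fcomp tF DF1 = fcomp DF0 tF;
  DF_i : fcomp DF1 iF = fcomp iF DF0;
  DF_c : forall e, fcomp DF1 cF =
    hc (fcomp DF1 (pb_fst sF tF)) (fcomp DF1 (pb_snd sF tF)) e
}.

Lemma dfunctor_ext (D E : DoubleCat) (F G : DoubleFunctor D E) :
  DF0 F = DF0 G -> DF1 F = DF1 G -> F = G.
Proof.
case: F => f0 f1 ? ? ? ?; case: G => g0 g1 ? ? ? ? /= e0 e1.
by subst; f_equal; apply: proof_irrelevance.
Qed.

Section HCompTheory.
Variable D : DoubleCat.

Lemma hc_congr X (U U' V V' : Functor X (D1 D)) e e' :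
  U = U' -> V = V' -> hc U V e = hc U' V' e'.
Proof. by move=> eU eV; rewrite /hc (pb_pair_congr e e'). Qed.

Lemma hc_pre X Y (U V : Functor X (D1 D)) (W : Functor Y X) e e' :
  fcomp (hc U V e) W = hc (fcomp U W) (fcomp V W) e'.
Proof. by rewrite /hc fcompA (pb_pair_pre e e'). Qed.

Lemma hc_s X (U V : Functor X (D1 D)) e : fcomp sF (hc U V e) = fcomp sF V.
Proof. by rewrite /hc -fcompA d_sc fcompA pb_snd_pair. Qed.

Lemma hc_t X (U V : Functor X (D1 D)) e : fcomp tF (hc U V e) = fcomp tF U.
Proof. by rewrite /hc -fcompA d_tc fcompA pb_fst_pair. Qed.

Lemma hc_idl X (x : Functor X (D0 D)) (U : Functor X (D1 D)) e :
  x = fcomp tF U -> hc (fcomp iF x) U e = U.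
Proof.
move=> ex; subst.
have e0 : fcomp sF (fcomp iF tF) = fcomp tF (fid (D1 D)).
  by rewrite -fcompA d_si fcomp_idl fcomp_idr.
have := f_equal (fun K => fcomp K U) (d_idl e0).
rewrite fcomp_idl fcompA => H; rewrite -[RHS]H /hc; congr fcomp.
apply: pb_ext.
- by rewrite pb_fst_pair -[in RHS]fcompA pb_fst_pair fcompA.
- by rewrite pb_snd_pair -[in RHS]fcompA pb_snd_pair fcomp_idl.
Qed.

Lemma hc_idr X (x : Functor X (D0 D)) (U : Functor X (D1 D)) e :
  x = fcomp sF U -> hc U (fcomp iF x) e = U.
Proof.
move=> ex; subst.
have e0 : fcomp sF (fid (D1 D)) = fcomp tF (fcomp iF sF).
  by rewrite -fcompA d_ti fcomp_idl fcomp_idr.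
have := f_equal (fun K => fcomp K U) (d_idr e0).
rewrite fcomp_idl fcompA => H; rewrite -[RHS]H /hc; congr fcomp.
apply: pb_ext.
- by rewrite pb_fst_pair -[in RHS]fcompA pb_fst_pair fcomp_idl.
- by rewrite pb_snd_pair -[in RHS]fcompA pb_snd_pair fcompA.
Qed.

Lemma hc_assoc X (U V W : Functor X (D1 D)) e1 e2 e3 e4 :
  hc (hc U V e1) W e2 = hc U (hc V W e3) e4.
Proof.
have e5 : fcomp (fcomp sF (pb_snd (@sF D) tF)) (pb_pair e1) = fcomp tF W.
  by rewrite fcompA pb_snd_pair.
have sq := pb_sq (fcomp sF (pb_snd (@sF D) tF)) tF.
have a1 : fcomp sF (fcomp cF (pb_fst (fcomp sF (pb_snd (@sF D) tF)) tF)) =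
          fcomp tF (pb_snd (fcomp sF (pb_snd (@sF D) tF)) tF).
  by rewrite -fcompA d_sc.
have a2 : fcomp sF (fcomp (pb_snd (@sF D) tF)
                     (pb_fst (fcomp sF (pb_snd (@sF D) tF)) tF)) =
          fcomp tF (pb_snd (fcomp sF (pb_snd (@sF D) tF)) tF).
  by rewrite -fcompA.
have a3 : fcomp sF (fcomp (pb_fst (@sF D) tF)
                     (pb_fst (fcomp sF (pb_snd (@sF D) tF)) tF)) =
          fcomp tF (fcomp cF (pb_pair a2)).
  by rewrite -[RHS]fcompA d_tc fcompA pb_fst_pair -!fcompA pb_sq.
have := f_equal (fun K => fcomp K (pb_pair e5)) (d_assoc a1 a3).
rewrite /= !fcompA => H.
transitivity (fcomp cF (fcomp (pb_pair a1) (pb_pair e5))).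
  rewrite /hc; congr fcomp; apply: pb_ext.
    by rewrite pb_fst_pair -[in RHS]fcompA pb_fst_pair fcompA pb_fst_pair.
  by rewrite pb_snd_pair -[in RHS]fcompA !pb_snd_pair.
rewrite H /hc; congr fcomp; apply: pb_ext.
  by rewrite pb_fst_pair -[in LHS]fcompA pb_fst_pair fcompA !pb_fst_pair.
rewrite pb_snd_pair -[in LHS]fcompA pb_snd_pair fcompA; congr fcomp; apply: pb_ext.
  by rewrite pb_fst_pair -[in LHS]fcompA pb_fst_pair fcompA pb_fst_pair pb_snd_pair.
by rewrite pb_snd_pair -[in LHS]fcompA !pb_snd_pair.
Qed.

End HCompTheory.
Arguments hc_assoc {D X U V W} e1 e2 e3 e4.

Lemma df_pb_eq (D E : DoubleCat) (F : DoubleFunctor D E) :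
  fcomp sF (fcomp (DF1 F) (pb_fst (@sF D) tF)) =
  fcomp tF (fcomp (DF1 F) (pb_snd (@sF D) tF)).
Proof. by rewrite -!fcompA DF_s DF_t !fcompA pb_sq. Qed.

Lemma df_hc (D E : DoubleCat) (F : DoubleFunctor D E) X
    (U V : Functor X (D1 D)) e e' :
  fcomp (DF1 F) (hc U V e) = hc (fcomp (DF1 F) U) (fcomp (DF1 F) V) e'.
Proof.
rewrite /hc -fcompA (DF_c (df_pb_eq F)) /hc fcompA; congr fcomp.
apply: pb_ext.
- by rewrite -fcompA !pb_fst_pair fcompA pb_fst_pair.
- by rewrite -fcompA !pb_snd_pair fcompA pb_snd_pair.
Qed.

Definition dfid (D : DoubleCat) : DoubleFunctor D D.
Proof.
refine {| DF0 := fid (D0 D); DF1 := fid (D1 D) |}.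
1-3: by rewrite fcomp_idl fcomp_idr.
move=> e; rewrite fcomp_idl -[LHS]fcomp_idr /hc; congr fcomp.
apply: pb_ext.
- by rewrite pb_fst_pair fcomp_idl fcomp_idr.
- by rewrite pb_snd_pair fcomp_idl fcomp_idr.
Defined.

Definition dfcomp (C D E : DoubleCat) (G : DoubleFunctor D E)
  (F : DoubleFunctor C D) : DoubleFunctor C E.
Proof.
refine {| DF0 := fcomp (DF0 G) (DF0 F); DF1 := fcomp (DF1 G) (DF1 F) |}.
- by rewrite -fcompA DF_s fcompA DF_s -fcompA.
- by rewrite -fcompA DF_t fcompA DF_t -fcompA.
- by rewrite fcompA DF_i -fcompA DF_i fcompA.
- move=> e.
  have e1 := e; rewrite !fcompA in e1.
  by rewrite fcompA (DF_c (df_pb_eq F)) (df_hc _ e1); apply: hc_congr;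
     rewrite fcompA.
Defined.

(** A horizontal natural transformation is an internal natural transformation
    in [Cat]: a functor from [D0] to [E1]. *)
Record HNat (D E : DoubleCat) := {
  hn_src : DoubleFunctor D E;
  hn_tgt : DoubleFunctor D E;
  hn_fun : Functor (D0 D) (D1 E);
  hn_s : fcomp sF hn_fun = DF0 hn_src;
  hn_t : fcomp tF hn_fun = DF0 hn_tgt;
  hn_nat : forall e e',
    hc (DF1 hn_tgt) (fcomp hn_fun sF) e = hc (fcomp hn_fun tF) (DF1 hn_src) e'
}.

Arguments hn_nat {D E} h e e'.

Lemma hnat_ext (D E : DoubleCat) (S T : HNat D E) :
  hn_src S = hn_src T -> hn_tgt S = hn_tgt T -> hn_fun S = hn_fun T -> S = T.
Proof.
case: S => s t f ? ? ?; case: T => s' t' f' ? ? ? /= es et ef.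
by subst; f_equal; apply: proof_irrelevance.
Qed.

Lemma hn_nat_pre (D E : DoubleCat) (T : HNat D E) X (W : Functor X (D1 D)) e e' :
  hc (fcomp (DF1 (hn_tgt T)) W) (fcomp (hn_fun T) (fcomp sF W)) e =
  hc (fcomp (hn_fun T) (fcomp tF W)) (fcomp (DF1 (hn_src T)) W) e'.
Proof.
have p : fcomp sF (DF1 (hn_tgt T)) = fcomp tF (fcomp (hn_fun T) sF).
  by rewrite DF_s -fcompA hn_t.
have q : fcomp sF (fcomp (hn_fun T) tF) = fcomp tF (DF1 (hn_src T)).
  by rewrite DF_t -fcompA hn_s.
have := f_equal (fun K => fcomp K W) (hn_nat T p q).
have p' := e; rewrite -(fcompA (hn_fun T)) in p'.
have q' := e'; rewrite -(fcompA (hn_fun T)) in q'.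
rewrite (hc_pre p p') (hc_pre q q') => H.
by etransitivity; [|etransitivity; [exact: H|]]; apply: hc_congr; rewrite ?fcompA.
Qed.

Section SourceTarget.
Variables (D E : DoubleCat) (X Y : Category).

Lemma hc_sA (U V : Functor X (D1 D)) e (W : Functor Y X) :
  fcomp sF (fcomp (hc U V e) W) = fcomp sF (fcomp V W).
Proof. by rewrite -fcompA hc_s fcompA. Qed.
Lemma hc_tA (U V : Functor X (D1 D)) e (W : Functor Y X) :
  fcomp tF (fcomp (hc U V e) W) = fcomp tF (fcomp U W).
Proof. by rewrite -fcompA hc_t fcompA. Qed.
Lemma DF_sA (F : DoubleFunctor D E) (W : Functor X (D1 D)) :
  fcomp sF (fcomp (DF1 F) W) = fcomp (DF0 F) (fcomp sF W).
Proof. by rewrite -fcompA DF_s fcompA. Qed.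
Lemma DF_tA (F : DoubleFunctor D E) (W : Functor X (D1 D)) :
  fcomp tF (fcomp (DF1 F) W) = fcomp (DF0 F) (fcomp tF W).
Proof. by rewrite -fcompA DF_t fcompA. Qed.
Lemma DF_iA (F : DoubleFunctor D E) (W : Functor X (D0 D)) :
  fcomp (DF1 F) (fcomp iF W) = fcomp iF (fcomp (DF0 F) W).
Proof. by rewrite -fcompA DF_i fcompA. Qed.
Lemma hn_sA (T : HNat D E) (W : Functor X (D0 D)) :
  fcomp sF (fcomp (hn_fun T) W) = fcomp (DF0 (hn_src T)) W.
Proof. by rewrite -fcompA hn_s. Qed.
Lemma hn_tA (T : HNat D E) (W : Functor X (D0 D)) :
  fcomp tF (fcomp (hn_fun T) W) = fcomp (DF0 (hn_tgt T)) W.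
Proof. by rewrite -fcompA hn_t. Qed.
Lemma d_siA (W : Functor X (D0 D)) : fcomp sF (fcomp iF W) = W.
Proof. by rewrite -fcompA d_si fcomp_idl. Qed.
Lemma d_tiA (W : Functor X (D0 D)) : fcomp tF (fcomp iF W) = W.
Proof. by rewrite -fcompA d_ti fcomp_idl. Qed.

End SourceTarget.

Ltac st := rewrite /= ?(fcompA, hc_s, hc_t, hc_sA, hc_tA, DF_s, DF_t, DF_sA, DF_tA,
  hn_s, hn_t, hn_sA, hn_tA, d_si, d_ti, d_siA, d_tiA, DF_i, DF_iA, fcomp_idl, fcomp_idr).

Section HomCategory.
Variables D E : DoubleCat.

Definition hn_id (F : DoubleFunctor D E) : HNat D E.
Proof.
refine {| hn_src := F; hn_tgt := F; hn_fun := fcomp iF (DF0 F) |}.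
- by st.
- by st.
- move=> e e'.
  have p : fcomp sF (DF1 F) = fcomp tF (fcomp iF (fcomp (DF0 F) sF)) by st.
  have q : fcomp sF (fcomp iF (fcomp (DF0 F) tF)) = fcomp tF (DF1 F) by st.
  transitivity (hc (DF1 F) (fcomp iF (fcomp (DF0 F) sF)) p).
    by apply: hc_congr; rewrite ?fcompA.
  rewrite hc_idr; first by st.
  symmetry; transitivity (hc (fcomp iF (fcomp (DF0 F) tF)) (DF1 F) q); first by apply: hc_congr; rewrite ?fcompA.
  by apply: hc_idl; st.
Defined.

Lemma hn_cmp_eq (S T : HNat D E) :
  hn_src S = hn_tgt T -> fcomp sF (hn_fun S) = fcomp tF (hn_fun T).
Proof. by move=> p; rewrite hn_s hn_t p. Qed.

Definition hn_cmp (S T : HNat D E) (p : hn_src S = hn_tgt T) : HNat D E.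
Proof.
refine {| hn_src := hn_src T; hn_tgt := hn_tgt S;
          hn_fun := hc (hn_fun S) (hn_fun T) (hn_cmp_eq p) |}.
- by st.
- by st.
- move=> e e'; set s := hn_fun S; set t := hn_fun T.
  have a1 : fcomp sF (fcomp s sF) = fcomp tF (fcomp t (@sF D)) by rewrite /s /t; st; rewrite p.
  have a2 : fcomp sF (DF1 (hn_tgt S)) = fcomp tF (hc (fcomp s sF) (fcomp t sF) a1).
    by rewrite /s /t; st.
  have a3 : fcomp sF (DF1 (hn_tgt S)) = fcomp tF (fcomp s sF) by rewrite /s; st.
  have a4 : fcomp sF (hc (DF1 (hn_tgt S)) (fcomp s sF) a3) = fcomp tF (fcomp t sF).
    by rewrite /s /t; st; rewrite p.
  have a5 : fcomp sF (fcomp s tF) = fcomp tF (DF1 (hn_src S)) by rewrite /s; st.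
  have a6 : fcomp sF (hc (fcomp s tF) (DF1 (hn_src S)) a5) = fcomp tF (fcomp t sF).
    by rewrite /t; st; rewrite p.
  have a7 : fcomp sF (DF1 (hn_src S)) = fcomp tF (fcomp t sF).
    by rewrite /t; st; rewrite p.
  have a8 : fcomp sF (fcomp s tF) = fcomp tF (hc (DF1 (hn_src S)) (fcomp t sF) a7).
    by rewrite /s; st.
  have a9 : fcomp sF (fcomp t tF) = fcomp tF (DF1 (hn_src T)) by rewrite /t; st.
  have a10 : fcomp sF (fcomp s tF) = fcomp tF (hc (fcomp t tF) (DF1 (hn_src T)) a9).
    by rewrite /s /t; st; rewrite p.
  have a11 : fcomp sF (fcomp s tF) = fcomp tF (fcomp t (@tF D)).
    by rewrite /s /t; st; rewrite p.
  have a12 : fcomp sF (hc (fcomp s tF) (fcomp t tF) a11) = fcomp tF (DF1 (hn_src T)).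
    by rewrite /t; st.
  transitivity (hc (DF1 (hn_tgt S)) (hc (fcomp s sF) (fcomp t sF) a1) a2).
    by apply: hc_congr => //; apply: hc_pre.
  transitivity (hc (hc (DF1 (hn_tgt S)) (fcomp s sF) a3) (fcomp t sF) a4).
    by rewrite (hc_assoc a3 a4 a1 a2).
  transitivity (hc (hc (fcomp s tF) (DF1 (hn_src S)) a5) (fcomp t sF) a6).
    by apply: hc_congr => //; apply: hn_nat.
  rewrite (hc_assoc a5 a6 a7 a8).
  transitivity (hc (fcomp s tF) (hc (fcomp t tF) (DF1 (hn_src T)) a9) a10).
    apply: hc_congr => //.
    have b : fcomp sF (DF1 (hn_tgt T)) = fcomp tF (fcomp (hn_fun T) sF) by st.
    by rewrite -(hn_nat T b); apply: hc_congr => //; rewrite p.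
  rewrite -(hc_assoc a11 a12 a9 a10); apply: hc_congr => //.
  by rewrite (hc_pre _ a11).
Defined.

Definition dhom : Category.
Proof.
refine {| Ob := DoubleFunctor D E; Ar := HNat D E; dom := @hn_src D E;
          cod := @hn_tgt D E; idn := hn_id; cmp := hn_cmp |} => //.
- move=> T p; apply: hnat_ext => //=.
  by apply: hc_idl; st.
- move=> T p; apply: hnat_ext => //=.
  by apply: hc_idr; st.
- move=> S T U p q p' q'; apply: hnat_ext => //=.
  by symmetry; apply: hc_assoc.
Defined.

End HomCategory.

Lemma hc_swap (D : DoubleCat) X (a b c b' c' d : Functor X (D1 D))
    m m' e1 e2 e3 e1' e2' e3' :
  hc b c m = hc b' c' m' ->
  hc (hc a b e1) (hc c d e2) e3 = hc (hc a b' e1') (hc c' d e2') e3'.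
Proof.
move=> H.
have k1 : fcomp sF b = fcomp tF (hc c d e2) by st.
have k2 : fcomp sF a = fcomp tF (hc b (hc c d e2) k1) by st.
have k3 : fcomp sF (hc b c m) = fcomp tF d by st.
have k1' : fcomp sF b' = fcomp tF (hc c' d e2') by st.
have k2' : fcomp sF a = fcomp tF (hc b' (hc c' d e2') k1') by st.
have k3' : fcomp sF (hc b' c' m') = fcomp tF d by st.
rewrite (hc_assoc e1 e3 k1 k2) (hc_assoc e1' e3' k1' k2').
apply: hc_congr => //.
by rewrite -(hc_assoc m k3 e2 k1) -(hc_assoc m' k3' e2' k1'); apply: hc_congr.
Qed.

Lemma hn_hcmp_eq (C D E : DoubleCat) (S : HNat D E) (T : HNat C D) :
  fcomp sF (fcomp (hn_fun S) (DF0 (hn_tgt T))) =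
  fcomp tF (fcomp (DF1 (hn_src S)) (hn_fun T)).
Proof. by st. Qed.

(** Horizontal composite of the 2-cells [T : F => F'] and [S : G => G'], with
    components [S_(F' x)] after [G (T_x)]. *)
Definition hn_hcmp (C D E : DoubleCat) (S : HNat D E) (T : HNat C D) : HNat C E.
Proof.
refine {| hn_src := dfcomp (hn_src S) (hn_src T);
          hn_tgt := dfcomp (hn_tgt S) (hn_tgt T);
          hn_fun := hc (fcomp (hn_fun S) (DF0 (hn_tgt T)))
                       (fcomp (DF1 (hn_src S)) (hn_fun T)) (hn_hcmp_eq S T) |}.
- by st.
- by st.
- move=> e e' /=.
  set s := hn_fun S; set t := hn_fun T.
  set F := hn_src T; set F' := hn_tgt T; set G := hn_src S; set G' := hn_tgt S.
  have a1 : fcomp sF (fcomp s (fcomp (DF0 F') sF)) =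
            fcomp tF (fcomp (DF1 G) (fcomp t sF)).
    by rewrite /s /t; st.
  have a2 : fcomp sF (fcomp (DF1 G') (DF1 F')) =
            fcomp tF (hc (fcomp s (fcomp (DF0 F') sF)) (fcomp (DF1 G) (fcomp t sF)) a1).
    by rewrite /s /t; st.
  have a3 : fcomp sF (fcomp (DF1 G') (DF1 F')) = fcomp tF (fcomp s (fcomp (DF0 F') sF)).
    by rewrite /s; st.
  have a4 : fcomp sF (hc (fcomp (DF1 G') (DF1 F')) (fcomp s (fcomp (DF0 F') sF)) a3) =
            fcomp tF (fcomp (DF1 G) (fcomp t sF)).
    by rewrite /s /t; st.
  have a5 : fcomp sF (fcomp s (fcomp (DF0 F') tF)) = fcomp tF (fcomp (DF1 G) (DF1 F')).
    by rewrite /s; st.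
  have a6 : fcomp sF (hc (fcomp s (fcomp (DF0 F') tF)) (fcomp (DF1 G) (DF1 F')) a5) =
            fcomp tF (fcomp (DF1 G) (fcomp t sF)).
    by rewrite /t; st.
  have a7 : fcomp sF (fcomp (DF1 G) (DF1 F')) = fcomp tF (fcomp (DF1 G) (fcomp t sF)).
    by rewrite /t; st.
  have a8 : fcomp sF (fcomp s (fcomp (DF0 F') tF)) =
            fcomp tF (hc (fcomp (DF1 G) (DF1 F')) (fcomp (DF1 G) (fcomp t sF)) a7).
    by rewrite /s; st.
  have a9 : fcomp sF (fcomp (DF1 G) (fcomp t tF)) = fcomp tF (fcomp (DF1 G) (DF1 F)).
    by rewrite /t; st.
  have a10 : fcomp sF (fcomp s (fcomp (DF0 F') tF)) =
             fcomp tF (hc (fcomp (DF1 G) (fcomp t tF)) (fcomp (DF1 G) (DF1 F)) a9).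
    by rewrite /s /t; st.
  have a11 : fcomp sF (fcomp s (fcomp (DF0 F') tF)) =
             fcomp tF (fcomp (DF1 G) (fcomp t tF)).
    by rewrite /s /t; st.
  have a12 : fcomp sF (hc (fcomp s (fcomp (DF0 F') tF)) (fcomp (DF1 G) (fcomp t tF)) a11) =
             fcomp tF (fcomp (DF1 G) (DF1 F)).
    by rewrite /t; st.
  have c1 : fcomp sF (DF1 F') = fcomp tF (fcomp t sF) by rewrite /t; st.
  have c2 : fcomp sF (fcomp t tF) = fcomp tF (DF1 F) by rewrite /t; st.
  have d1 : fcomp sF (fcomp (fcomp s (DF0 F')) sF) =
            fcomp tF (fcomp (fcomp (DF1 G) t) (@sF C)) by rewrite /s /t; st.
  have d2 : fcomp sF (fcomp (fcomp s (DF0 F')) tF) =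
            fcomp tF (fcomp (fcomp (DF1 G) t) (@tF C)) by rewrite /s /t; st.
  transitivity (hc (fcomp (DF1 G') (DF1 F')) _ a2).
    apply: hc_congr => //; rewrite (hc_pre _ d1); apply: hc_congr; exact: fcompA.
  rewrite -(hc_assoc a3 a4 a1 a2).
  transitivity (hc _ (fcomp (DF1 G) (fcomp t sF)) a6).
    apply: hc_congr => //.
    have b1 := a3; rewrite -DF_s in b1.
    have b2 := a5; rewrite -DF_t in b2.
    transitivity (hc (fcomp (DF1 G') (DF1 F')) (fcomp s (fcomp sF (DF1 F'))) b1).
      by apply: hc_congr; rewrite ?DF_s.
    transitivity (hc (fcomp s (fcomp tF (DF1 F'))) (fcomp (DF1 G) (DF1 F')) b2).
      exact: hn_nat_pre.
    by apply: hc_congr; rewrite ?DF_t.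
  rewrite (hc_assoc a5 a6 a7 a8).
  transitivity (hc (fcomp s (fcomp (DF0 F') tF)) _ a10).
    apply: hc_congr => //.
    by rewrite -(df_hc c1 a7) -(df_hc c2 a9); congr fcomp; apply: hn_nat.
  rewrite -(hc_assoc a11 a12 a9 a10); apply: hc_congr => //.
  by rewrite (hc_pre _ d2); apply: hc_congr; rewrite fcompA.
Defined.

Definition dcomp (C D E : DoubleCat) :
  Functor (product (dhom D E) (dhom C D)) (dhom C E).
Proof.
refine (@Build_Functor (product (dhom D E) (dhom C D)) (dhom C E)
  (fun GF => dfcomp (fst GF) (snd GF)) (fun ST => hn_hcmp (fst ST) (snd ST)) _ _ _ _) => //.
- move=> [G F]; apply: hnat_ext => //=.
  have q : fcomp sF (fcomp iF (fcomp (DF0 G) (DF0 F))) =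
           fcomp tF (fcomp (DF1 G) (fcomp iF (DF0 F))) by st.
  transitivity (hc (fcomp iF (fcomp (DF0 G) (DF0 F))) (fcomp (DF1 G) (fcomp iF (DF0 F))) q).
    by apply: hc_congr; rewrite ?fcompA.
  rewrite (hc_idl q); st => //.
- move=> [S' T'] [S T] p q; apply: hnat_ext => //=.
  have p1 : hn_src S' = hn_tgt S := f_equal fst p.
  have p2 : hn_src T' = hn_tgt T := f_equal snd p.
  set s := hn_fun S; set t := hn_fun T; set s' := hn_fun S'; set t' := hn_fun T'.
  have a1 : fcomp sF (fcomp s' (DF0 (hn_tgt T'))) = fcomp tF (fcomp s (DF0 (hn_tgt T'))).
    by rewrite /s /s'; st; rewrite p1.
  have a2 : fcomp sF (fcomp (DF1 (hn_src S)) t') = fcomp tF (fcomp (DF1 (hn_src S)) t).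
    by rewrite /t /t'; st; rewrite p2.
  have a3 : fcomp sF (hc (fcomp s' (DF0 (hn_tgt T'))) (fcomp s (DF0 (hn_tgt T'))) a1) =
            fcomp tF (hc (fcomp (DF1 (hn_src S)) t') (fcomp (DF1 (hn_src S)) t) a2).
    by rewrite /s /t'; st.
  have m : fcomp sF (fcomp s (DF0 (hn_tgt T'))) = fcomp tF (fcomp (DF1 (hn_src S)) t').
    by rewrite /s /t'; st.
  have m' : fcomp sF (fcomp (DF1 (hn_src S')) t') = fcomp tF (fcomp s (DF0 (hn_tgt T))).
    by rewrite /s /t'; st; rewrite p1 p2.
  transitivity (hc _ _ a3).
    by apply: hc_congr; [apply: hc_pre | apply: df_hc].
  apply: (hc_swap (m := m) (m' := m')).
  have b1 := m'; rewrite p1 -p2 -(hn_s T') in b1.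
  have b2 := m; rewrite -(hn_t T') in b2.
  transitivity (hc _ _ b2); first by apply: hc_congr => //; rewrite hn_t.
  transitivity (hc _ _ b1); first by symmetry; apply: hn_nat_pre.
  by apply: hc_congr; rewrite ?p1 // hn_s p2.
Defined.

(** Strict 2-categories, as categories enriched in [Cat]. *)
Record TwoCat := {
  ob2c : Type;
  hom2c : ob2c -> ob2c -> Category;
  id2c : forall a, Ob (hom2c a a);
  comp2c : forall a b c, Functor (product (hom2c b c) (hom2c a b)) (hom2c a c);
  idl2c_ob : forall a b (f : Ob (hom2c a b)), F_ob (comp2c a b b) (id2c b, f) = f;
  idl2c_ar : forall a b (f : Ar (hom2c a b)),
    F_ar (comp2c a b b) (idn (id2c b), f) = f;
  idr2c_ob : forall a b (f : Ob (hom2c a b)), F_ob (comp2c a a b) (f, id2c a) = f;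
  idr2c_ar : forall a b (f : Ar (hom2c a b)),
    F_ar (comp2c a a b) (f, idn (id2c a)) = f;
  assoc2c_ob : forall a b c d (h : Ob (hom2c c d)) (g : Ob (hom2c b c)) (f : Ob (hom2c a b)),
    F_ob (comp2c a c d) (h, F_ob (comp2c a b c) (g, f)) =
    F_ob (comp2c a b d) (F_ob (comp2c b c d) (h, g), f);
  assoc2c_ar : forall a b c d (h : Ar (hom2c c d)) (g : Ar (hom2c b c)) (f : Ar (hom2c a b)),
    F_ar (comp2c a c d) (h, F_ar (comp2c a b c) (g, f)) =
    F_ar (comp2c a b d) (F_ar (comp2c b c d) (h, g), f)
}.
Arguments hom2c {_} _ _.
Arguments id2c {_} _.
Arguments comp2c {_} _ _ _.

Definition DblCat_h : TwoCat.
Proof.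
refine {| ob2c := DoubleCat; hom2c := dhom; id2c := dfid; comp2c := dcomp |} => /=.
- by move=> C D F; apply: dfunctor_ext; apply: fcomp_idl.
- move=> C D T; apply: hnat_ext => /=.
  + by apply: dfunctor_ext; apply: fcomp_idl.
  + by apply: dfunctor_ext; apply: fcomp_idl.
  + have e : fcomp sF (fcomp iF (DF0 (hn_tgt T))) = fcomp tF (hn_fun T) by st.
    transitivity (hc _ _ e); last by apply: hc_idl; st.
    by apply: hc_congr; rewrite ?fcomp_idl ?fcomp_idr.
- by move=> C D F; apply: dfunctor_ext; apply: fcomp_idr.
- move=> C D T; apply: hnat_ext => /=.
  + by apply: dfunctor_ext; apply: fcomp_idr.
  + by apply: dfunctor_ext; apply: fcomp_idr.
  + have e : fcomp sF (hn_fun T) = fcomp tF (fcomp iF (DF0 (hn_src T))) by st.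
    transitivity (hc _ _ e); last by apply: hc_idr; st.
    by apply: hc_congr; st.
- by move=> A B C D H G F; apply: dfunctor_ext; rewrite /= fcompA.
- move=> A B C D R S T; apply: hnat_ext => /=.
  + by apply: dfunctor_ext; rewrite /= fcompA.
  + by apply: dfunctor_ext; rewrite /= fcompA.
  + set r := hn_fun R; set s := hn_fun S; set t := hn_fun T.
    set H := hn_src R; set G := hn_src S; set G' := hn_tgt S; set F' := hn_tgt T.
    have a1 : fcomp sF (fcomp r (fcomp (DF0 G') (DF0 F'))) =
              fcomp tF (fcomp (DF1 H) (fcomp s (DF0 F'))) by rewrite /r /s; st.
    have a2 : fcomp sF (fcomp (DF1 H) (fcomp s (DF0 F'))) =
              fcomp tF (fcomp (DF1 H) (fcomp (DF1 G) t)) by rewrite /s /t; st.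
    have a3 : fcomp sF (hc _ _ a1) = fcomp tF (fcomp (DF1 H) (fcomp (DF1 G) t)).
      by st.
    have a4 : fcomp sF (fcomp r (fcomp (DF0 G') (DF0 F'))) = fcomp tF (hc _ _ a2).
      by st.
    have b : fcomp sF (fcomp (fcomp r (DF0 G')) (DF0 F')) =
             fcomp tF (fcomp (fcomp (DF1 H) s) (DF0 F')) by rewrite /r /s; st.
    transitivity (hc _ _ a4).
      by apply: hc_congr => //; apply: df_hc.
    rewrite -(hc_assoc a1 a3 a2 a4); apply: hc_congr; last by rewrite fcompA.
    by rewrite (hc_pre _ b); apply: hc_congr; rewrite fcompA.
Defined.

(** The functor [K(E, f) : K(E, A) -> K(E, B)], acting on 2-cells by whiskering. *)
Definition hom_post (K : TwoCat) (E A B : ob2c K) (f : Ob (hom2c A B)) :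
  Functor (hom2c E A) (hom2c E B).
Proof.
refine (@Build_Functor (hom2c E A) (hom2c E B)
  (fun a => F_ob (comp2c E A B) (f, a)) (fun al => F_ar (comp2c E A B) (idn f, al))
  _ _ _ _).
- by move=> al; rewrite F_dom /= dom_idn.
- by move=> al; rewrite F_cod /= cod_idn.
- by move=> a; rewrite -F_idn.
- move=> g al p q.
  have r : dom ((idn f, g) : Ar (product (hom2c A B) (hom2c E A))) =
           cod ((idn f, al) : Ar (product (hom2c A B) (hom2c E A))).
    by rewrite /= dom_idn cod_idn p.
  rewrite -(F_cmp _ r q); congr F_ar => /=; congr pair; last exact: cmp_congr.
  have r' : dom (idn f) = cod (idn (dom (idn f))) by rewrite cod_idn.
  by rewrite -[LHS](cmp_idr r'); apply: cmp_congr => //; rewrite dom_idn.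
Defined.

Record Cat1 := {
  obj : Type;
  mor : obj -> obj -> Type;
  id1 : forall a, mor a a;
  comp1 : forall x y z, mor y z -> mor x y -> mor x z;
  idl1 : forall a b (f : mor a b), comp1 (id1 b) f = f;
  idr1 : forall a b (f : mor a b), comp1 f (id1 a) = f;
  assoc1 : forall a b c d (h : mor c d) (g : mor b c) (f : mor a b),
    comp1 h (comp1 g f) = comp1 (comp1 h g) f
}.
Arguments mor {_} _ _.
Arguments id1 {_} _.
Arguments comp1 {_ _ _ _} _ _.

Definition class (C : Cat1) := forall a b : obj C, mor a b -> Prop.

(** [i] has the left lifting property against [p]. *)
Definition lifts (C : Cat1) (a b x y : obj C) (i : mor a b) (p : mor x y) : Prop :=
  forall (u : mor a x) (v : mor b y), comp1 p u = comp1 v i ->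
    exists d : mor b x, comp1 d i = u /\ comp1 p d = v.

Definition retract_of (C : Cat1) (a b x y : obj C) (f : mor a b) (g : mor x y) : Prop :=
  exists (i : mor a x) (r : mor x a) (j : mor b y) (s : mor y b),
    comp1 r i = id1 a /\ comp1 s j = id1 b /\
    comp1 g i = comp1 j f /\ comp1 f r = comp1 s g.

Definition closed_under_retracts (C : Cat1) (W : class C) : Prop :=
  forall (a b x y : obj C) (f : mor a b) (g : mor x y),
    retract_of f g -> W _ _ g -> W _ _ f.

Record ModelStructure (C : Cat1) := {
  weq : class C;
  fib : class C;
  cof : class C;
  two_of_three_comp : forall a b c (g : mor b c) (f : mor a b),
    weq f -> weq g -> weq (comp1 g f);
  two_of_three_left : forall a b c (g : mor b c) (f : mor a b),
    weq f -> weq (comp1 g f) -> weq g;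
  two_of_three_right : forall a b c (g : mor b c) (f : mor a b),
    weq g -> weq (comp1 g f) -> weq f;
  weq_retract : closed_under_retracts weq;
  fib_retract : closed_under_retracts fib;
  cof_retract : closed_under_retracts cof;
  lift_cof_tfib : forall a b x y (i : mor a b) (p : mor x y),
    cof i -> fib p -> weq p -> lifts i p;
  lift_tcof_fib : forall a b x y (i : mor a b) (p : mor x y),
    cof i -> weq i -> fib p -> lifts i p;
  factor_cof_tfib : forall a b (f : mor a b),
    exists c (i : mor a c) (p : mor c b), comp1 p i = f /\ cof i /\ fib p /\ weq p;
  factor_tcof_fib : forall a b (f : mor a b),
    exists c (i : mor a c) (p : mor c b), comp1 p i = f /\ cof i /\ weq i /\ fib p
}.

Definition underlying (K : TwoCat) : Cat1.
Proof.
refine {| obj := ob2c K; mor := fun a b => Ob (hom2c a b); id1 := id2c;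
          comp1 := fun a b c g f => F_ob (comp2c a b c) (g, f) |}.
- exact: idl2c_ob.
- exact: idr2c_ob.
- exact: assoc2c_ob.
Defined.

Section Trivial.
Variable K : TwoCat.

Definition trivial_weq : class (underlying K) := fun A B f =>
  forall E, equivalence (hom_post E f).

Definition trivial_fib : class (underlying K) := fun A B f =>
  forall E, isofibration (hom_post E f).

Definition trivial_cof : class (underlying K) := fun A B i =>
  forall (X Y : obj (underlying K)) (p : mor X Y),
    trivial_fib p -> trivial_weq p -> lifts i p.

End Trivial.

(** Cofibrations are not prescribed: in a model structure they are the morphisms
    with the left lifting property against acyclic fibrations, hence they
    satisfy [trivial_cof]. *)
Definition is_trivial (K : TwoCat) (N : ModelStructure (underlying K)) : Prop :=
  forall (A B : obj (underlying K)) (f : mor A B),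
    (weq N f <-> trivial_weq f) /\ (fib N f <-> trivial_fib f).

Definition CAT : Cat1.
Proof.
refine {| obj := Category; mor := Functor; id1 := fid; comp1 := fcomp |}.
- exact: fcomp_idl.
- exact: fcomp_idr.
- by move=> A B C D H G F; rewrite fcompA.
Defined.

Definition is_categorical (M : ModelStructure CAT) : Prop :=
  forall (A B : Category) (F : Functor A B),
    (weq M F <-> equivalence F) /\
    (fib M F <-> isofibration F) /\
    (cof M F <-> injective_on_objects F).

Record Functor1 (C D : Cat1) := {
  fun_obj : obj C -> obj D;
  fun_mor : forall a b, mor a b -> mor (fun_obj a) (fun_obj b);
  fun_id : forall a, fun_mor (id1 a) = id1 (fun_obj a);
  fun_comp : forall a b c (g : mor b c) (f : mor a b),
    fun_mor (comp1 g f) = comp1 (fun_mor g) (fun_mor f)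
}.
Arguments fun_mor {C D} _ {a b} _.

Definition full_embedding (C D : Cat1) (H : Functor1 C D) : Prop :=
  (forall a b, fun_obj H a = fun_obj H b -> a = b) /\
  (forall a b (g : mor (fun_obj H a) (fun_obj H b)), exists! f : mor a b, fun_mor H f = g).

Definition extends_along (C D : Cat1) (H : Functor1 C D)
    (M : ModelStructure C) (N : ModelStructure D) : Prop :=
  full_embedding H /\
  forall (a b : obj C) (f : mor a b),
    (weq M f <-> weq N (fun_mor H f)) /\
    (fib M f <-> fib N (fun_mor H f)) /\
    (cof M f <-> cof N (fun_mor H f)).

Definition DblCat : Cat1 := underlying DblCat_h.

Definition hcomposition (A : Category) :
  Functor (pullback (discrete_map (@dom A)) (discrete_map (@cod A))) (discrete (Ar A)).
Proof.
refine (@Build_Functor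
  (pullback (discrete_map (@dom A)) (discrete_map (@cod A))) (discrete (Ar A))
  (fun x => @cmp A (ob1 x) (ob2 x) (ob_eq x)) (fun x => @cmp A (ar1 x) (ar2 x) (ar_eq x))
  _ _ _ _).
- by move=> f; apply: (@cmp_congr A).
- by move=> f; apply: (@cmp_congr A).
- by move=> x; apply: (@cmp_congr A).
- by move=> g f p q; apply: (@cmp_congr A).
Defined.

(** Objects and morphisms of [A] become objects and horizontal morphisms, that
    is, objects of the discrete categories [D0] and [D1]. *)
Definition horizontal (A : Category) : DoubleCat.
Proof.
refine (@Build_DoubleCat (discrete (Ob A)) (discrete (Ar A))
  (discrete_map (@dom A)) (discrete_map (@cod A)) (discrete_map (@idn A))
  (hcomposition A) _ _ _ _ _ _ _) => /=.
- by apply: functor_ext => x; apply: (@dom_idn A).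
- by apply: functor_ext => x; apply: (@cod_idn A).
- by apply: functor_ext => x; apply: (@dom_cmp A).
- by apply: functor_ext => x; apply: (@cod_cmp A).
- by move=> e; apply: functor_ext => x; apply: (@cmp_idl A).
- by move=> e; apply: functor_ext => x; apply: (@cmp_idr A).
- by move=> e1 e2 e3; apply: functor_ext => x; symmetry; apply: (@cmp_assoc A).
Defined.

Definition horizontal_map (A B : Category) (F : Functor A B) :
  DoubleFunctor (horizontal A) (horizontal B).
Proof.
refine (@Build_DoubleFunctor (horizontal A) (horizontal B)
  (discrete_map (F_ob F)) (discrete_map (F_ar F)) _ _ _ _).
- by apply: functor_ext => x; apply: (F_dom F).
- by apply: functor_ext => x; apply: (F_cod F).
- by apply: functor_ext => x; apply: (F_idn F).
- by move=> e; apply: functor_ext => x; apply: (F_cmp F).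
Defined.

Definition HH : Functor1 CAT DblCat.
Proof.
refine (@Build_Functor1 CAT DblCat horizontal horizontal_map _ _).
- by move=> A; apply: dfunctor_ext; apply: functor_ext.
- by move=> A B C G F; apply: dfunctor_ext; apply: functor_ext.
Defined.

(* Main.v *)
(** The horizontal embedding [H] has a right adjoint [hor], sending a double
    category to its category of objects and horizontal morphisms, with
    [hor (H A) = A].  A double functor [H 1 -> X] is an object of [hor X] and a
    horizontal transformation between two of them is a morphism of [hor X], so
    [hor P] is a retract of [K(H 1, P)]: this reflects equivalences and
    isofibrations.  Conversely [K(E, H F)] inherits them from [F], because a
    double functor [E -> H A] is a pair of functions on objects and horizontal
    morphisms which are constant along vertical morphisms and squares; a choice
    of lifts that depends only on the data in [A] and [B] respects this
    constancy.  For cofibrations, lifting [H F] against [P] amounts to lifting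
    [F] against the surjective equivalence [hor P], and conversely [F] is
    injective on objects as soon as [H F] lifts against [H] of the surjective
    equivalence from the chaotic category on the objects of [A] to [1]. *)
From Stdlib Require Import ssreflect ProofIrrelevance Classical IndefiniteDescription.
Require Import Defs.

Set Implicit Arguments.
Unset Strict Implicit.
Unset Printing Implicit Defensive.

(** * Categories *)

(** Composition as a relation, so that its typing proofs stay out of equations. *)
Definition composite (A : Category) (g f h : Ar A) : Prop :=
  exists p : dom g = cod f, cmp g f p = h.

Section Composite.
Variable A : Category.
Implicit Types f g h k x y : Ar A.

Lemma cmp_composite g f (p : dom g = cod f) : composite g f (cmp g f p).
Proof. by exists p. Qed.

Lemma composite_cmp g f h : composite g f h -> forall p, cmp g f p = h.
Proof. by case=> q <- p; apply: cmp_congr. Qed.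

Lemma composite_ex g f : dom g = cod f -> exists h, composite g f h.
Proof. by move=> p; exists (cmp g f p); exists p. Qed.

Lemma composite_uniq g f h h' : composite g f h -> composite g f h' -> h = h'.
Proof. by case=> p <- /composite_cmp. Qed.

Lemma composite_mid g f h : composite g f h -> dom g = cod f.
Proof. by case. Qed.

Lemma composite_dom g f h : composite g f h -> dom h = dom f.
Proof. by case=> p <-; apply: dom_cmp. Qed.

Lemma composite_cod g f h : composite g f h -> cod h = cod g.
Proof. by case=> p <-; apply: cod_cmp. Qed.

Lemma composite_idl f : composite (idn (cod f)) f f.
Proof. by exists (dom_idn _); apply: cmp_idl. Qed.

Lemma composite_idr f : composite f (idn (dom f)) f.
Proof. by exists (eq_sym (cod_idn _)); apply: cmp_idr. Qed.

Lemma composite_assoc h g f hg gf k :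
  composite h g hg -> composite g f gf -> composite hg f k <-> composite h gf k.
Proof.
case=> p <- [q <-].
have r : dom h = cod (cmp g f q) by rewrite cod_cmp.
have r' : dom (cmp h g p) = cod f by rewrite dom_cmp.
have E := @cmp_assoc A h g f q r p r'.
split=> [/composite_cmp <-|/composite_cmp <-].
- by exists r; rewrite E.
- by exists r'; rewrite -E.
Qed.

Arguments composite_assoc {h g f hg gf} k.

Lemma is_isoP f :
  is_iso f <-> exists g, composite g f (idn (dom f)) /\ composite f g (idn (cod f)).
Proof.
split; first by case=> g [p [q [e1 e2]]]; exists g; split; [exists p|exists q].
by case=> g [[p e1] [q e2]]; exists g, p, q.
Qed.

Lemma iso_cancel h x y k : is_iso h -> composite h x k -> composite h y k -> x = y.
Proof.
case/is_isoP=> g [gh hg] hx hy.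
have key z : composite h z k -> composite g k z.
  move=> hz; apply/(composite_assoc _ gh hz).
  by rewrite (composite_mid hz); apply: composite_idl.
exact: composite_uniq (key _ hx) (key _ hy).
Qed.

Lemma iso_cancel_r h x y k : is_iso h -> composite x h k -> composite y h k -> x = y.
Proof.
case/is_isoP=> g [gh hg] hx hy.
have key z : composite z h k -> composite k g z.
  move=> hz; apply/(composite_assoc _ hz hg).
  by rewrite -(composite_mid hz); apply: composite_idr.
exact: composite_uniq (key _ hx) (key _ hy).
Qed.

Lemma iso_divide h k : is_iso h -> cod h = cod k -> exists x, composite h x k.
Proof.
case/is_isoP=> g [gh hg] e.
have eg : dom g = cod k by rewrite -e -(composite_dom hg) dom_idn.
case: (composite_ex eg) => x gx; exists x.
by apply/(composite_assoc _ hg gx); rewrite e; apply: composite_idl.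
Qed.

Lemma iso_inverse f : is_iso f ->
  exists g, composite g f (idn (dom f)) /\ composite f g (idn (cod f)) /\ is_iso g.
Proof.
case/is_isoP=> g [gf fg]; exists g; split=> //; split=> //.
apply/is_isoP; exists f.
by rewrite (composite_mid gf) -(composite_mid fg).
Qed.

(** Multiplying [g s = t f] by [t'] on the left and by [s'] on the right gives [f s' = t' g]. This
    turns a naturality square into the square of the inverse components. *)
Lemma inverse_square s s' t t' f g k :
  composite s s' (idn (cod s)) -> composite t' t (idn (dom t)) ->
  composite g s k -> composite t f k ->
  exists m, composite f s' m /\ composite t' g m.
Proof.
move=> ss tt gs tf.
have t'k : composite t' k f.
  by apply/(composite_assoc _ tt tf); rewrite (composite_mid tf); apply: composite_idl.
have ks : composite k s' g.
  by apply/(composite_assoc _ gs ss); rewrite -(composite_mid gs); apply: composite_idr.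
case: (composite_ex (g := f) (f := s')) => [|m fm].
  by rewrite -(composite_dom tf) (composite_mid ks).
by exists m; split=> //; apply/(composite_assoc _ t'k ks).
Qed.

End Composite.

(** * Functors, natural isomorphisms and equivalences of categories *)

Lemma composite_map (A B : Category) (F : Functor A B) (g f h : Ar A) :
  composite g f h -> composite (F_ar F g) (F_ar F f) (F_ar F h).
Proof.
case=> p <-.
have q : dom (F_ar F g) = cod (F_ar F f) by rewrite F_dom F_cod p.
by exists q; rewrite (F_cmp F p q).
Qed.

Lemma is_iso_map (A B : Category) (F : Functor A B) (f : Ar A) :
  is_iso f -> is_iso (F_ar F f).
Proof.
case/is_isoP=> g [gf fg]; apply/is_isoP; exists (F_ar F g).
by rewrite F_dom F_cod -!F_idn; split; apply: composite_map.
Qed.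

Lemma functor_eq_ob (A B : Category) (F G : Functor A B) (e : F = G) x :
  F_ob F x = F_ob G x.
Proof. by rewrite e. Qed.

Lemma functor_eq_ar (A B : Category) (F G : Functor A B) (e : F = G) f :
  F_ar F f = F_ar G f.
Proof. by rewrite e. Qed.

Lemma nat_isoP (A B : Category) (F G : Functor A B) :
  nat_iso F G <-> exists t : Ob A -> Ar B,
    (forall x, dom (t x) = F_ob F x) /\ (forall x, cod (t x) = F_ob G x) /\
    (forall x, is_iso (t x)) /\
    (forall f, exists k, composite (F_ar G f) (t (dom f)) k /\
                         composite (t (cod f)) (F_ar F f) k).
Proof.
split=> [[t [td [tc [ti tn]]]]|[t [td [tc [ti tn]]]]]; exists t.
- split=> //; split=> //; split=> // f.
  have p : dom (F_ar G f) = cod (t (dom f)) by rewrite F_dom tc.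
  have q : dom (t (cod f)) = cod (F_ar F f) by rewrite F_cod td.
  by exists (cmp _ _ p); split; [exists p|exists q; rewrite tn].
- exists td, tc; split=> // f p q; case: (tn f) => k [k1 k2].
  by rewrite (composite_cmp k1) (composite_cmp k2).
Qed.

Lemma nat_iso_whisker (A B C D : Category) (K : Functor C D) (F G : Functor B C)
    (H : Functor A B) :
  nat_iso F G -> nat_iso (fcomp K (fcomp F H)) (fcomp K (fcomp G H)).
Proof.
case/nat_isoP=> t [td [tc [ti tn]]]; apply/nat_isoP.
exists (fun x => F_ar K (t (F_ob H x))); split=> [x|]; first by rewrite F_dom td.
split=> [x|]; first by rewrite F_cod tc.
split=> [x|f]; first exact: is_iso_map.
case: (tn (F_ar H f)) => k; rewrite F_dom F_cod => -[k1 k2].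
exists (F_ar K k); split => /=; exact: composite_map.
Qed.

Lemma nat_iso_sym_components (A B : Category) (F G : Functor A B) :
  nat_iso F G -> forall x, exists b, is_iso b /\ dom b = F_ob G x /\ cod b = F_ob F x.
Proof.
case/nat_isoP=> t [td [tc [ti tn]]] x.
case: (iso_inverse (ti x)) => b [bt [tb bi]]; exists b; split=> //.
by rewrite -(composite_dom tb) -(composite_cod bt) dom_idn cod_idn.
Qed.

(** The pseudo-inverse is [r G' j]; whiskering the two natural isomorphisms for [G] by the
    retraction data yields those for [F]. *)
Lemma equivalence_retract (A B X Y : Category) (F : Functor A B) (G : Functor X Y) :
  @retract_of CAT A B X Y F G -> equivalence G -> equivalence F.
Proof.
case=> i [r [j [s [/= ri [sj [Gi Fr]]]]]] [G' [n1 n2]].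
exists (fcomp r (fcomp G' j)); split.
- have := nat_iso_whisker r i n1.
  by rewrite fcomp_idl ri !fcompA Gi.
- have := nat_iso_whisker s j n2.
  by rewrite fcomp_idl sj -!fcompA Fr.
Qed.

(** Push the isomorphism forward along [j], lift it through [G], and bring the lift back along
    [r]. *)
Lemma isofibration_retract (A B X Y : Category) (F : Functor A B) (G : Functor X Y) :
  @retract_of CAT A B X Y F G -> isofibration G -> isofibration F.
Proof.
case=> i [r [j [s [/= ri [sj [Gi Fr]]]]]] fG a b bi bc.
have c : cod (F_ar j b) = F_ob G (F_ob i a).
  by rewrite F_cod bc; symmetry; apply: (functor_eq_ob Gi a).
case: (fG _ _ (is_iso_map j bi) c) => al [ali [alc alb]].
exists (F_ar r al); split; first exact: is_iso_map.
split; first by rewrite F_cod alc; apply: (functor_eq_ob ri a).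
rewrite -[LHS]/(F_ar (fcomp F r) al) Fr /= alb.
exact: (functor_eq_ar sj b).
Qed.

(** By naturality of [t], an arrow with given ends is recovered from its image under [G P] by
    cancelling an invertible component. *)
Lemma faithful_of_retraction (X Y : Category) (P : Functor X Y) (G : Functor Y X) :
  nat_iso (fid X) (fcomp G P) ->
  forall f g, dom f = dom g -> cod f = cod g -> F_ar P f = F_ar P g -> f = g.
Proof.
case/nat_isoP=> t [_ [_ [ti tn]]] f g ed ec e.
case: (tn f) => k [/= k1 k2]; case: (tn g) => l [/= l1 l2].
apply: iso_cancel (ti (cod f)) k2 _; rewrite ec.
by rewrite e ed in k1; rewrite (composite_uniq k1 l1).
Qed.

Lemma faithful_of_section (X Y : Category) (P : Functor X Y) (G : Functor Y X) :
  nat_iso (fcomp P G) (fid Y) ->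
  forall f g, dom f = dom g -> cod f = cod g -> F_ar G f = F_ar G g -> f = g.
Proof.
case/nat_isoP=> t [_ [_ [ti tn]]] f g ed ec e.
case: (tn f) => k [/= k1 k2]; case: (tn g) => l [/= l1 l2].
apply: iso_cancel_r (ti (dom f)) k1 _; rewrite ed.
by rewrite e ec in k2; rewrite (composite_uniq k2 l2).
Qed.

Lemma equivalence_full (X Y : Category) (P : Functor X Y) : equivalence P ->
  forall (x y : Ob X) (h : Ar Y), dom h = F_ob P x -> cod h = F_ob P y ->
  exists f, dom f = x /\ cod f = y /\ F_ar P f = h.
Proof.
case=> G [/nat_isoP [t [td [tc [ti tn]]]] n2] x y h hd hc.
have p : dom (F_ar G h) = cod (t x) by rewrite F_dom tc hd.
case: (composite_ex p) => k hk.
have q : cod (t y) = cod k by rewrite (composite_cod hk) F_cod tc hc.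
(* The candidate is [f = t_y^-1 (G h) t_x]. *)
case: (iso_divide (ti y) q) => f hf.
have fd : dom f = x by rewrite -(composite_dom hf) (composite_dom hk) td.
have fc : cod f = y by rewrite -(composite_mid hf) td.
exists f; split=> //; split=> //.
(* [G] is faithful, so it suffices to compare [G (P f)] with [G h]; naturality of [t] at [f] does
   this. *)
apply: (faithful_of_section n2); rewrite ?F_dom ?F_cod ?fd ?fc //.
case: (tn f) => l; rewrite /= fd fc => -[l1 l2].
by apply: iso_cancel_r (ti x) l1 _; rewrite -(composite_uniq hf l2).
Qed.

(** The isomorphism from [y] to [P (G y)] lifts to an arrow ending at [G y], and the domain of the
    lift lies over [y]. *)
Lemma equivalence_isofibration_surjective (X Y : Category) (P : Functor X Y) :
  equivalence P -> isofibration P -> forall y, exists x, F_ob P x = y.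
Proof.
case=> G [_ n2] fP y.
case: (nat_iso_sym_components n2 y) => b [bi [bd bc]].
case: (fP _ _ bi bc) => al [_ [_ e]].
by exists (dom al); rewrite -F_dom e.
Qed.

Lemma injective_lifts (A B X Y : Category) (F : Functor A B) (P : Functor X Y) :
  injective_on_objects F -> equivalence P -> isofibration P -> @lifts CAT A B X Y F P.
Proof.
move=> iF eP fP u v /= sq.
have fa : forall f g, dom f = dom g -> cod f = cod g -> F_ar P f = F_ar P g -> f = g.
  by case: eP => G [n1 _]; apply: faithful_of_retraction n1.
(* On the image of [F] the lift is forced by [u], and injectivity makes this unambiguous; elsewhere
   any preimage of [v b] under the surjective [P] will do. *)
have ob b : exists x, F_ob P x = F_ob v b /\ forall a, F_ob F a = b -> x = F_ob u a.
  case: (classic (exists a, F_ob F a = b)) => [[a <-]|na].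
    exists (F_ob u a); split; first exact: (functor_eq_ob sq a).
    by move=> a' /iF ->.
  case: (equivalence_isofibration_surjective eP fP (F_ob v b)) => x ex.
  by exists x; split=> // a ea; case: na; exists a.
case: (functional_choice _ ob) => d0 d0P {ob}.
(* Fullness of [P] defines the lift on arrows; faithfulness [fa] then gives the functor laws and
   agreement with [u]. *)
have ar h : exists f, dom f = d0 (dom h) /\ cod f = d0 (cod h) /\ F_ar P f = F_ar v h.
  apply: equivalence_full => //; rewrite ?F_dom ?F_cod; symmetry; apply d0P.
case: (functional_choice _ ar) => d1 d1P {ar}.
have dd h : dom (d1 h) = d0 (dom h) by apply d1P.
have dc h : cod (d1 h) = d0 (cod h) by apply d1P.
have dP h : F_ar P (d1 h) = F_ar v h by apply d1P.
have di b : d1 (idn b) = idn (d0 b).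
  apply: fa; rewrite ?dd ?dc ?dP ?dom_idn ?cod_idn ?F_idn //.
  by case: (d0P b) => ->.
have dm g f p q : d1 (cmp g f p) = cmp (d1 g) (d1 f) q.
  apply: fa; rewrite ?dd ?dc ?dP ?dom_cmp ?cod_cmp ?dd ?dc //.
  have p' : dom (F_ar v g) = cod (F_ar v f) by rewrite F_dom F_cod p.
  have q' : dom (F_ar P (d1 g)) = cod (F_ar P (d1 f)) by rewrite F_dom F_cod q.
  by rewrite (F_cmp v p p') (F_cmp P q q'); apply: cmp_congr.
exists (Build_Functor dd dc di dm); split; apply: functor_ext => /=.
- by move=> a; apply (proj2 (d0P (F_ob F a))).
- move=> f; have e a : d0 (F_ob F a) = F_ob u a by apply (proj2 (d0P (F_ob F a))).
  apply: fa; rewrite ?dd ?dc ?F_dom ?F_cod ?e //.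
  by rewrite dP; symmetry; apply: (functor_eq_ar sq f).
- by move=> b; apply d0P.
- exact: dP.
Qed.

(** * Functors into and out of discrete categories *)

Lemma to_discrete_dom (A : Category) (T : Type) (F : Functor A (discrete T)) f :
  F_ar F f = F_ob F (dom f).
Proof. exact: (F_dom F f). Qed.

Lemma to_discrete_vertical (A : Category) (T : Type) (F : Functor A (discrete T)) f :
  F_ob F (dom f) = F_ob F (cod f).
Proof. by rewrite -to_discrete_dom; apply: (F_cod F f). Qed.

Lemma to_discrete_ext (A : Category) (T : Type) (F G : Functor A (discrete T)) :
  (forall x, F_ob F x = F_ob G x) -> F = G.
Proof. by move=> e; apply: functor_ext => // f; rewrite !to_discrete_dom e. Qed.

Definition to_discrete (A : Category) (T : Type) (h : Ob A -> T)
  (e : forall f, h (dom f) = h (cod f)) : Functor A (discrete T).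
Proof.
refine (@Build_Functor A (discrete T) h (fun f => h (dom f)) _ _ _ _) => //.
- by move=> x; rewrite dom_idn.
- by move=> g f p q; rewrite dom_cmp.
Defined.

Definition from_discrete (T : Type) (A : Category) (h : T -> Ob A) :
  Functor (discrete T) A.
Proof.
refine (@Build_Functor (discrete T) A h (fun x => idn (h x)) _ _ _ _) => //.
- by move=> x; apply: dom_idn.
- by move=> x; apply: cod_idn.
- move=> g f p q; move: p q => /= <- q.
  by have := composite_idl (idn (h g)); rewrite cod_idn => /composite_cmp ->.
Defined.

(** Also covers a pullback of discrete categories, which has only identities but is not of the form
    [discrete T]. *)
Lemma identities_ext (A B : Category) (F G : Functor A B) :
  (forall f : Ar A, f = idn (dom f)) -> (forall x, F_ob F x = F_ob G x) -> F = G.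
Proof.
by move=> iA e; apply: functor_ext => // f; rewrite (iA f) !F_idn e.
Qed.

Lemma from_discrete_ext (T : Type) (B : Category) (F G : Functor (discrete T) B) :
  (forall x, F_ob F x = F_ob G x) -> F = G.
Proof. exact: identities_ext. Qed.

(** * The adjunction between [horizontal] and [hor] *)

Lemma cF_ext (X : DoubleCat) (x y : pb_ob (@sF X) tF) :
  ob1 x = ob1 y -> ob2 x = ob2 y -> F_ob cF x = F_ob cF y.
Proof. by move=> e1 e2; rewrite (pb_ob_ext e1 e2). Qed.

Section Hor.
Variable X : DoubleCat.

Definition hor : Category.
Proof.
refine {| Ob := Ob (D0 X); Ar := Ob (D1 X); dom := F_ob sF; cod := F_ob tF;
          idn := F_ob iF; cmp := fun g f p => F_ob cF (Build_pb_ob p) |}.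
- exact: (functor_eq_ob (@d_si X)).
- exact: (functor_eq_ob (@d_ti X)).
- by move=> g f p; apply: (functor_eq_ob (@d_sc X)).
- by move=> g f p; apply: (functor_eq_ob (@d_tc X)).
- move=> f p.
  have e : fcomp sF (fcomp iF tF) = fcomp tF (fid (D1 X)) by st.
  rewrite -[RHS](functor_eq_ob (d_idl e) f) /=; exact: cF_ext.
- move=> f p.
  have e : fcomp sF (fid (D1 X)) = fcomp tF (fcomp iF sF) by st.
  rewrite -[RHS](functor_eq_ob (d_idr e) f) /=; exact: cF_ext.
- move=> h g f p q p' q'.
  (* Single horizontal morphisms become functors out of a one-object category, to which [hc_assoc]
     applies. *)
  set U := from_discrete (fun _ : unit => h).
  set V := from_discrete (fun _ : unit => g).
  set W := from_discrete (fun _ : unit => f).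
  have e1 : fcomp sF U = fcomp tF V by apply: from_discrete_ext.
  have e3 : fcomp sF V = fcomp tF W by apply: from_discrete_ext.
  have e2 : fcomp sF (hc U V e1) = fcomp tF W by rewrite hc_s.
  have e4 : fcomp sF U = fcomp tF (hc V W e3) by rewrite hc_t.
  have := functor_eq_ob (hc_assoc e1 e2 e3 e4) tt; rewrite /hc /= => H.
  transitivity (F_ob (hc U (hc V W e3) e4) tt).
    apply: cF_ext => //=; exact: cF_ext.
  rewrite -(hc_assoc e1 e2 e3 e4).
  apply: cF_ext => //=; exact: cF_ext.
Defined.

Lemma hc_composite (A : Category) (U V : Functor A (D1 X)) e x :
  @composite hor (F_ob U x) (F_ob V x) (F_ob (hc U V e) x).
Proof. by exists (functor_eq_ob e x); apply: cF_ext. Qed.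

End Hor.

Definition hor_map (X Y : DoubleCat) (P : DoubleFunctor X Y) : Functor (hor X) (hor Y).
Proof.
refine (@Build_Functor (hor X) (hor Y) (F_ob (DF0 P)) (F_ob (DF1 P)) _ _ _ _).
- exact: (functor_eq_ob (DF_s P)).
- exact: (functor_eq_ob (DF_t P)).
- exact: (functor_eq_ob (DF_i P)).
- move=> g f p q.
  apply: eq_trans (functor_eq_ob (DF_c (df_pb_eq P)) (@Build_pb_ob _ _ _ (@sF X) tF g f p)) _.
  exact: cF_ext.
Defined.

Definition transpose (A : Category) (X : DoubleCat)
  (u : DoubleFunctor (horizontal A) X) : Functor A (hor X).
Proof.
refine (@Build_Functor A (hor X) (F_ob (DF0 u)) (F_ob (DF1 u)) _ _ _ _).
- exact: (functor_eq_ob (DF_s u)).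
- exact: (functor_eq_ob (DF_t u)).
- exact: (functor_eq_ob (DF_i u)).
- exact: (@F_cmp _ _ (hor_map u)).
Defined.

Definition cotranspose (A : Category) (X : DoubleCat) (d : Functor A (hor X)) :
  DoubleFunctor (horizontal A) X.
Proof.
refine (@Build_DoubleFunctor (horizontal A) X
  (@from_discrete (Ob A) (D0 X) (F_ob d)) (@from_discrete (Ar A) (D1 X) (F_ar d)) _ _ _ _).
- by apply: from_discrete_ext; apply: (F_dom d).
- by apply: from_discrete_ext; apply: (F_cod d).
- by apply: from_discrete_ext; apply: (F_idn d).
- move=> e; apply: identities_ext => [f|x].
    by apply: pb_ar_ext.
  have q : @dom (hor X) (F_ar d (ob1 x)) = cod (F_ar d (ob2 x)).
    by rewrite F_dom F_cod; apply: f_equal; apply: (ob_eq x).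
  by apply: eq_trans (F_cmp d (ob_eq x) q) _; apply: cF_ext.
Defined.

Lemma horizontal_dfunctor_ext (A : Category) (X : DoubleCat)
    (u v : DoubleFunctor (horizontal A) X) :
  transpose u = transpose v -> u = v.
Proof.
move=> e; apply: dfunctor_ext; apply: from_discrete_ext.
- exact: (functor_eq_ob e).
- exact: (functor_eq_ar e).
Qed.

(** The data agree by computation and the laws by proof irrelevance. A strict equality is what makes
    the embedding injective on objects. *)
Lemma hor_horizontal (A : Category) : hor (horizontal A) = A.
Proof.
case: A => O M d c i m ? ? ? ? ? ? ?; rewrite /hor /=.
f_equal; apply: proof_irrelevance.
Qed.

(** * Hom categories *)

(** Whiskering is a horizontal composite with the identity 2-cell of [P], whose identity components
    drop out. *)
Lemma hom_post_fun (E X Y : DoubleCat) (P : DoubleFunctor X Y) (T : HNat E X) :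
  hn_fun (F_ar (@hom_post DblCat_h E X Y P) T) = fcomp (DF1 P) (hn_fun T).
Proof.
have q : fcomp sF (fcomp iF (fcomp (DF0 P) (DF0 (hn_tgt T)))) =
         fcomp tF (fcomp (DF1 P) (hn_fun T)) by st.
transitivity (hc _ _ q); last by apply: hc_idl; st.
by apply: hc_congr; st.
Qed.

(** The sources and targets of the 2-cells already agree because the functors agree on objects. *)
Lemma to_dhom_ext (C : Category) (E X : DoubleCat) (F G : Functor C (dhom E X)) :
  (forall a, F_ob F a = F_ob G a) ->
  (forall f, hn_fun (F_ar F f) = hn_fun (F_ar G f)) -> F = G.
Proof.
move=> e0 e1; apply: functor_ext => // T; apply: hnat_ext => //.
- apply: (eq_trans (F_dom F T)); rewrite e0; exact: eq_sym (F_dom G T).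
- apply: (eq_trans (F_cod F T)); rewrite e0; exact: eq_sym (F_cod G T).
Qed.

Lemma hom_post_id (E X : DoubleCat) : @hom_post DblCat_h E X X (dfid X) = fid (dhom E X).
Proof.
apply: to_dhom_ext => [a|T]; first exact: (idl2c_ob (t := DblCat_h)).
by rewrite hom_post_fun; apply: fcomp_idl.
Qed.

Lemma hom_post_comp (E X Y Z : DoubleCat) (Q : DoubleFunctor Y Z) (P : DoubleFunctor X Y) :
  @hom_post DblCat_h E X Z (dfcomp Q P) =
  fcomp (@hom_post DblCat_h E Y Z Q) (@hom_post DblCat_h E X Y P).
Proof.
apply: to_dhom_ext => [a|T]; first by apply: dfunctor_ext; rewrite /= fcompA.
by rewrite hom_post_fun [in RHS]hom_post_fun hom_post_fun fcompA.
Qed.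

(** Reduces composites and invertibility of 2-cells to their components; for [E = H 1] it is the
    retraction of [constant]. *)
Definition eval_at (E X : DoubleCat) (e : Ob (D0 E)) : Functor (dhom E X) (hor X).
Proof.
refine (@Build_Functor (dhom E X) (hor X) (fun a => F_ob (DF0 a) e)
  (fun T => F_ob (hn_fun T) e) _ _ _ _) => //.
- by move=> T; apply: (functor_eq_ob (hn_s T)).
- by move=> T; apply: (functor_eq_ob (hn_t T)).
- by move=> S T p q; symmetry; apply: (composite_cmp (hc_composite _ _)).
Defined.

Definition point (A : Category) (x : Ob A) : Functor (discrete unit) A :=
  from_discrete (fun _ => x).

Definition constant_hnat (X : DoubleCat) (f : Ar (hor X)) :
  HNat (horizontal (discrete unit)) X.
Proof.
refine (@Build_HNat (horizontal (discrete unit)) X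
  (cotranspose (point (dom f))) (cotranspose (point (cod f)))
  (@from_discrete unit (D1 X) (fun _ => f)) _ _ _).
- exact: from_discrete_ext.
- exact: from_discrete_ext.
- move=> e e'; apply: from_discrete_ext => x.
  (* The only horizontal morphism of [H 1] is an identity, so both composites reduce to [f] by the
     unit laws. *)
  transitivity (f : Ob (D1 X)).
  + exact: composite_uniq (hc_composite e x) (@composite_idl (hor X) f).
  + exact: eq_sym (composite_uniq (hc_composite e' x) (@composite_idr (hor X) f)).
Defined.

Definition constant (X : DoubleCat) : Functor (hor X) (dhom (horizontal (discrete unit)) X).
Proof.
refine (@Build_Functor (hor X) (dhom (horizontal (discrete unit)) X)
  (fun x => cotranspose (point x)) (@constant_hnat X) _ _ _ _) => //=.
- move=> x; apply: hnat_ext => /=.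
  + exact: (f_equal (fun y => cotranspose (point y)) (dom_idn (c := hor X) x)).
  + exact: (f_equal (fun y => cotranspose (point y)) (cod_idn (c := hor X) x)).
  + exact: from_discrete_ext.
- move=> g f p q; apply: hnat_ext => /=.
  + exact: (f_equal (fun y => cotranspose (point y)) (dom_cmp (c := hor X) p)).
  + exact: (f_equal (fun y => cotranspose (point y)) (cod_cmp (c := hor X) p)).
  + apply: from_discrete_ext => x.
    exact: cF_ext.
Defined.

Lemma hor_map_retract (X Y : DoubleCat) (P : DoubleFunctor X Y) :
  @retract_of CAT _ _ _ _ (hor_map P)
    (@hom_post DblCat_h (horizontal (discrete unit)) X Y P).
Proof.
exists (constant X), (@eval_at (horizontal (discrete unit)) X tt),
  (constant Y), (@eval_at (horizontal (discrete unit)) Y tt).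
split; first exact: functor_ext.
split; first exact: functor_ext.
split.
- apply: to_dhom_ext => [x|f].
  + by apply: horizontal_dfunctor_ext; apply: from_discrete_ext.
  + rewrite [LHS]hom_post_fun; exact: from_discrete_ext.
- apply: functor_ext => // T; exact: eq_sym (functor_eq_ob (hom_post_fun P T) tt).
Qed.

Lemma hnat_composite (E X : DoubleCat) (T : HNat E X) (f : Ob (D1 E)) :
  exists k,
    @composite (hor X) (F_ob (DF1 (hn_tgt T)) f) (F_ob (hn_fun T) (F_ob sF f)) k /\
    @composite (hor X) (F_ob (hn_fun T) (F_ob tF f)) (F_ob (DF1 (hn_src T)) f) k.
Proof.
have e : fcomp sF (DF1 (hn_tgt T)) = fcomp tF (fcomp (hn_fun T) sF) by st.
have e' : fcomp sF (fcomp (hn_fun T) tF) = fcomp tF (DF1 (hn_src T)) by st.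
exists (F_ob (hc _ _ e) f); split; first exact: (hc_composite e f).
rewrite (hn_nat T e e'); exact: (hc_composite e' f).
Qed.

(** * Double functors and transformations into a horizontal embedding *)

Section ToHorizontal.
Variables (E : DoubleCat) (A : Category).

Definition to_horizontal (p0 : Functor (D0 E) (discrete (Ob A)))
  (p1 : Functor (D1 E) (discrete (Ar A)))
  (ps : forall f, @dom A (F_ob p1 f) = F_ob p0 (F_ob sF f))
  (pt : forall f, @cod A (F_ob p1 f) = F_ob p0 (F_ob tF f))
  (pi : forall x, F_ob p1 (F_ob iF x) = @idn A (F_ob p0 x))
  (pc : forall x : pb_ob sF tF,
     @composite A (F_ob p1 (ob1 x)) (F_ob p1 (ob2 x)) (F_ob p1 (F_ob cF x))) :
  DoubleFunctor E (horizontal A).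
Proof.
refine (@Build_DoubleFunctor E (horizontal A) p0 p1 _ _ _ _).
- exact: to_discrete_ext.
- exact: to_discrete_ext.
- exact: to_discrete_ext.
- move=> e; apply: to_discrete_ext => x.
  exact: eq_sym (composite_cmp (pc x) _).
Defined.

Definition hnat_to_horizontal (a b : DoubleFunctor E (horizontal A))
  (al : Functor (D0 E) (discrete (Ar A)))
  (ad : forall e, @dom A (F_ob al e) = F_ob (DF0 a) e)
  (ac : forall e, @cod A (F_ob al e) = F_ob (DF0 b) e)
  (an : forall f, exists k,
     @composite A (F_ob (DF1 b) f) (F_ob al (F_ob sF f)) k /\
     @composite A (F_ob al (F_ob tF f)) (F_ob (DF1 a) f) k) :
  HNat E (horizontal A).
Proof.
refine (@Build_HNat E (horizontal A) a b al _ _ _).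
- exact: to_discrete_ext.
- exact: to_discrete_ext.
- move=> e e'; apply: to_discrete_ext => f; case: (an f) => k [k1 k2].
  exact: eq_trans (composite_cmp k1 _) (eq_sym (composite_cmp k2 _)).
Defined.

Lemma hnat_horizontal_dom (T : HNat E (horizontal A)) e :
  @dom A (F_ob (hn_fun T) e) = F_ob (DF0 (hn_src T)) e.
Proof. exact: (functor_eq_ob (hn_s T) e). Qed.

Lemma hnat_horizontal_cod (T : HNat E (horizontal A)) e :
  @cod A (F_ob (hn_fun T) e) = F_ob (DF0 (hn_tgt T)) e.
Proof. exact: (functor_eq_ob (hn_t T) e). Qed.

Lemma hnat_horizontal_nat (T : HNat E (horizontal A)) f : exists k,
    @composite A (F_ob (DF1 (hn_tgt T)) f) (F_ob (hn_fun T) (F_ob sF f)) k /\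
    @composite A (F_ob (hn_fun T) (F_ob tF f)) (F_ob (DF1 (hn_src T)) f) k.
Proof. exact: (hnat_composite T f). Qed.

(** Cancelling the invertible components from the naturality squares shows that target and
    components determine the source. *)
Lemma hnat_horizontal_eq (S T : HNat E (horizontal A)) :
  hn_tgt S = hn_tgt T -> hn_fun S = hn_fun T ->
  (forall e, @is_iso A (F_ob (hn_fun T) e)) -> S = T.
Proof.
move=> et ef iT; apply: hnat_ext => //; apply: dfunctor_ext; apply: to_discrete_ext.
  by move=> e; rewrite -!hnat_horizontal_dom ef.
move=> f; case: (hnat_horizontal_nat S f) => k; rewrite et ef => -[k1 k2].
case: (hnat_horizontal_nat T f) => l [l1 l2].
by apply: iso_cancel (iT _) k2 _; rewrite (composite_uniq k1 l1).
Qed.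

Lemma hnat_horizontal_iso (T : HNat E (horizontal A)) :
  (forall e, @is_iso A (F_ob (hn_fun T) e)) -> @is_iso (dhom E (horizontal A)) T.
Proof.
move=> iT.
(* Inverses are chosen per arrow of [A], not per object of [E], so that they form a functor on
   [D0 E]; an arrow without inverse gets itself as default value. *)
have inv (f : Ar A) : exists g, is_iso f ->
    composite g f (idn (dom f)) /\ composite f g (idn (cod f)) /\ is_iso g.
  case: (classic (is_iso f)) => [/iso_inverse [g gP]|nf]; first by exists g.
  by exists f.
case: (functional_choice _ inv) => h hP {inv}.
have gf e := proj1 (hP _ (iT e)).
have fg e := proj1 (proj2 (hP _ (iT e))).
have gi e := proj2 (proj2 (hP _ (iT e))).
have hd e : @dom A (h (F_ob (hn_fun T) e)) = F_ob (DF0 (hn_tgt T)) e.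
  by rewrite -hnat_horizontal_cod -(composite_dom (fg e)) dom_idn.
have hc e : @cod A (h (F_ob (hn_fun T) e)) = F_ob (DF0 (hn_src T)) e.
  by rewrite -hnat_horizontal_dom -(composite_cod (gf e)) cod_idn.
have hn f : exists k,
    @composite A (F_ob (DF1 (hn_src T)) f) (h (F_ob (hn_fun T) (F_ob sF f))) k /\
    @composite A (h (F_ob (hn_fun T) (F_ob tF f))) (F_ob (DF1 (hn_tgt T)) f) k.
  case: (hnat_horizontal_nat T f) => k [k1 k2].
  exact: inverse_square (fg _) (gf _) k1 k2.
pose S := @hnat_to_horizontal (hn_tgt T) (hn_src T)
  (fcomp (discrete_map h) (hn_fun T)) hd hc hn.
exists S; exists eq_refl, eq_refl; split; apply: hnat_ext => //; apply: to_discrete_ext => e.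
- have := (composite_cmp (gf e)); rewrite hnat_horizontal_dom; apply.
- have := (composite_cmp (fg e)); rewrite hnat_horizontal_cod; apply.
Qed.
(** The source of [T] is [a] conjugated by [al]. *)
Lemma conjugate_horizontal (a : DoubleFunctor E (horizontal A))
    (al : Functor (D0 E) (discrete (Ar A))) :
  (forall e, @is_iso A (F_ob al e)) ->
  (forall e, @cod A (F_ob al e) = F_ob (DF0 a) e) ->
  exists T : HNat E (horizontal A), hn_tgt T = a /\ hn_fun T = al.
Proof.
move=> ai ac.
have as_ f : @dom A (F_ob (DF1 a) f) = cod (F_ob al (F_ob sF f)).
  by rewrite ac; apply: (functor_eq_ob (DF_s a) f).
(* The new source sends [f] to [al_t^-1 (a f) al_s], with [s] and [t] the horizontal ends of [f]. *)
have ex f : exists x : Ar A, exists k,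
    @composite A (F_ob (DF1 a) f) (F_ob al (F_ob sF f)) k /\
    @composite A (F_ob al (F_ob tF f)) x k.
  case: (composite_ex (as_ f)) => k fk.
  have c : @cod A (F_ob al (F_ob tF f)) = cod k.
    by rewrite ac (composite_cod fk); symmetry; apply: (functor_eq_ob (DF_t a) f).
  by case: (iso_divide (ai _) c) => x kx; exists x, k.
case: (functional_choice _ ex) => g gP {ex}.
(* Uniqueness of the arrow completing the square; constancy, units and composites below all reduce
   to it. *)
have gu f x : (exists k, @composite A (F_ob (DF1 a) f) (F_ob al (F_ob sF f)) k /\
    @composite A (F_ob al (F_ob tF f)) x k) -> g f = x.
  case=> k [k1 k2]; case: (gP f) => l [l1 l2].
  by apply: iso_cancel (ai _) l2 _; rewrite (composite_uniq l1 k1).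
(* The square defining [g f] depends on [f] only through functors into discrete categories, hence is
   the same at both ends of [u]. *)
have gv u : g (dom u) = g (cod u).
  apply: gu; move: (gP (cod u)).
  by rewrite -!F_cod -!F_dom !(to_discrete_vertical, F_dom, F_cod).
have gs f : @dom A (g f) = dom (F_ob al (F_ob sF f)).
  by case: (gP f) => k [k1 k2]; rewrite -(composite_dom k2) (composite_dom k1).
have gt f : @cod A (g f) = dom (F_ob al (F_ob tF f)).
  by case: (gP f) => k [_ k2]; rewrite -(composite_mid k2).
have gi x : g (F_ob iF x) = idn (dom (F_ob al x)).
  apply: gu.
  have -> : F_ob sF (F_ob iF x) = x by apply: (functor_eq_ob (@d_si E) x).
  have -> : F_ob tF (F_ob iF x) = x by apply: (functor_eq_ob (@d_ti E) x).
  have -> : F_ob (DF1 a) (F_ob iF x) = @idn A (cod (F_ob al x)).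
    by rewrite ac; apply: (functor_eq_ob (DF_i a) x).
  by exists (F_ob al x); split; [apply: composite_idl|apply: composite_idr].
have gm (x : pb_ob (@sF E) tF) : @composite A (g (ob1 x)) (g (ob2 x)) (g (F_ob cF x)).
  have p : @dom A (g (ob1 x)) = cod (g (ob2 x)) by rewrite gs gt (ob_eq x).
  case: (composite_ex p) => m cm; rewrite (gu (F_ob cF x) m) //.
  have -> : F_ob sF (F_ob cF x) = F_ob sF (ob2 x) := functor_eq_ob (@d_sc E) x.
  have -> : F_ob tF (F_ob cF x) = F_ob tF (ob1 x) := functor_eq_ob (@d_tc E) x.
  case: (gP (ob1 x)) => k [k1 k2]; case: (gP (ob2 x)) => l [l1 l2].
  have ca : @composite A (F_ob (DF1 a) (ob1 x)) (F_ob (DF1 a) (ob2 x))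
      (F_ob (DF1 a) (F_ob cF x)).
    have q : @dom A (F_ob (DF1 a) (ob1 x)) = cod (F_ob (DF1 a) (ob2 x)).
      by rewrite as_ ac (ob_eq x); symmetry; apply: (functor_eq_ob (DF_t a) (ob2 x)).
    exists q; apply: (eq_trans _ (eq_sym (functor_eq_ob (DF_c (df_pb_eq a)) x))).
    exact: (@cmp_congr A).
  rewrite -(ob_eq x) in l2.
  (* [n] is the common diagonal of the two naturality squares pasted side by side. *)
  case: (composite_ex (g := F_ob (DF1 a) (ob1 x)) (f := l)) => [|n an].
    by rewrite (composite_cod l1) (composite_mid ca).
  exists n; split; first by apply/(composite_assoc _ ca l1).
  apply/(composite_assoc _ k2 cm); apply/(composite_assoc _ k1 l2).
  exact: an.
pose p0 := fcomp (discrete_map (@dom A)) al.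
pose a' := @to_horizontal p0 (to_discrete gv) gs gt gi gm.
by exists (@hnat_to_horizontal a' a al (fun e => eq_refl) ac gP).
Qed.

End ToHorizontal.

Lemma nat_iso_hom_post (E : DoubleCat) (A B : Category) (F G : Functor A B) :
  nat_iso F G ->
  nat_iso (@hom_post DblCat_h E (horizontal A) (horizontal B) (horizontal_map F))
          (@hom_post DblCat_h E (horizontal A) (horizontal B) (horizontal_map G)).
Proof.
case/nat_isoP=> t [td [tc [ti tn]]].
(* Naturality of [t] enters twice: here at the arrow [a f], so that each [T a] is a transformation,
   and later at the components of [S], for naturality in [a]. *)
have an (a : DoubleFunctor E (horizontal A)) f : exists k,
    @composite B (F_ar G (F_ob (DF1 a) f)) (t (F_ob (DF0 a) (F_ob sF f))) k /\
    @composite B (t (F_ob (DF0 a) (F_ob tF f))) (F_ar F (F_ob (DF1 a) f)) k.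
  have -> : F_ob (DF0 a) (F_ob sF f) = @dom A (F_ob (DF1 a) f).
    exact: eq_sym (functor_eq_ob (DF_s a) f).
  have -> : F_ob (DF0 a) (F_ob tF f) = @cod A (F_ob (DF1 a) f).
    exact: eq_sym (functor_eq_ob (DF_t a) f).
  exact: tn.
pose T (a : DoubleFunctor E (horizontal A)) : HNat E (horizontal B) :=
  @hnat_to_horizontal E B (dfcomp (horizontal_map F) a) (dfcomp (horizontal_map G) a)
    (fcomp (discrete_map t) (DF0 a)) (fun e => td _) (fun e => tc _) (an a).
apply/nat_isoP; exists T; split=> //; split=> //; split=> [a|S].
  by apply: hnat_horizontal_iso => e; apply: ti.
have p : @dom (dhom E (horizontal B))
    (F_ar (@hom_post DblCat_h E _ _ (horizontal_map G)) S) =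
    @cod (dhom E (horizontal B)) (T (hn_src S)).
  exact: (F_dom (@hom_post DblCat_h E _ _ (horizontal_map G)) S).
have q : @dom (dhom E (horizontal B)) (T (hn_tgt S)) =
    @cod (dhom E (horizontal B)) (F_ar (@hom_post DblCat_h E _ _ (horizontal_map F)) S).
  exact: eq_sym (F_cod (@hom_post DblCat_h E _ _ (horizontal_map F)) S).
exists (cmp _ _ p); split; first by exists p.
exists q; symmetry; apply: hnat_ext.
- exact: (F_dom (@hom_post DblCat_h E _ _ (horizontal_map F)) S).
- exact: (F_cod (@hom_post DblCat_h E _ _ (horizontal_map G)) S).
- apply: to_discrete_ext => e.
  case: (tn (F_ob (hn_fun S) e)) => k.
  rewrite hnat_horizontal_dom hnat_horizontal_cod => -[k1 k2].
  transitivity k.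
  + apply: (composite_uniq (composite_map (eval_at (horizontal B) e) (cmp_composite p))).
    by rewrite -(functor_eq_ob (hom_post_fun (horizontal_map G) S) e : _ = F_ar G _) in k1.
  + symmetry.
    apply: (composite_uniq (composite_map (eval_at (horizontal B) e) (cmp_composite q))).
    by rewrite -(functor_eq_ob (hom_post_fun (horizontal_map F) S) e : _ = F_ar F _) in k2.
Qed.

Lemma equivalence_hom_post (E : DoubleCat) (A B : Category) (F : Functor A B) :
  equivalence F ->
  equivalence (@hom_post DblCat_h E (horizontal A) (horizontal B) (horizontal_map F)).
Proof.
case=> G [n1 n2].
exists (@hom_post DblCat_h E (horizontal B) (horizontal A) (horizontal_map G)).
have HHid C : horizontal_map (fid C) = dfid (horizontal C) := fun_id HH C.
have HHcomp C D K (Q : Functor D K) (P : Functor C D) :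
  horizontal_map (fcomp Q P) = dfcomp (horizontal_map Q) (horizontal_map P)
  := @fun_comp _ _ HH _ _ _ Q P.
split; rewrite -hom_post_comp -hom_post_id -HHid -HHcomp; exact: nat_iso_hom_post.
Qed.

Lemma isofibration_hom_post (E : DoubleCat) (A B : Category) (F : Functor A B) :
  isofibration F ->
  isofibration (@hom_post DblCat_h E (horizontal A) (horizontal B) (horizontal_map F)).
Proof.
move=> fF a be bei bt; change (hn_tgt be = dfcomp (horizontal_map F) a) in bt.
have ib e : @is_iso B (F_ob (hn_fun be) e) := is_iso_map (eval_at (horizontal B) e) bei.
(* One lift is fixed for each pair of an object of [A] and an arrow of [B]; [idn x] is the default
   where no lifting problem is posed. *)
have lift (xb : Ob A * Ar B) : exists al, is_iso (snd xb) -> cod (snd xb) = F_ob F (fst xb) ->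
    is_iso al /\ cod al = fst xb /\ F_ar F al = snd xb.
  case: xb => x b /=; case: (classic (is_iso b /\ cod b = F_ob F x)) => [[bi bc]|nb].
    by case: (fF _ _ bi bc) => al alP; exists al.
  by exists (idn x) => bi bc; case: nb.
case: (functional_choice _ lift) => h hP {lift}.
pose g e : Ar A := h (F_ob (DF0 a) e, F_ob (hn_fun be) e).
have gv u : g (dom u) = g (cod u) by rewrite /g !to_discrete_vertical.
have gP e : is_iso (g e) /\ cod (g e) = F_ob (DF0 a) e /\ F_ar F (g e) = F_ob (hn_fun be) e.
  apply: (hP (F_ob (DF0 a) e, F_ob (hn_fun be) e)) => //=.
  by apply: (eq_trans (hnat_horizontal_cod be e)); rewrite bt.
have gi e : is_iso (g e) by apply gP.
have gc e : cod (g e) = F_ob (DF0 a) e by apply gP.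
have gF e : F_ar F (g e) = F_ob (hn_fun be) e by apply gP.
pose al : Functor (D0 E) (discrete (Ar A)) := to_discrete gv.
(* The lifts are components only; conjugating [a] by them supplies the source double functor. *)
case: (conjugate_horizontal (a := a) (al := al) gi gc) => T [Tt Tf].
exists T; split.
  by apply: hnat_horizontal_iso => e; rewrite Tf; apply: gi.
split=> //; apply: hnat_horizontal_eq => //.
- by rewrite bt -Tt.
- by rewrite hom_post_fun Tf; apply: to_discrete_ext.
Qed.

(** * Preservation and reflection *)

Definition chaotic (T : Type) : Category.
Proof.
refine {| Ob := T; Ar := T * T; dom := fst; cod := snd; idn := fun x => (x, x);
          cmp := fun g f _ => (fst f, snd g) |} => //.
- by case.
- by case.
Defined.

Definition to_chaotic (A : Category) (T : Type) (h : Ob A -> T) : Functor A (chaotic T).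
Proof.
refine (@Build_Functor A (chaotic T) h (fun f => (h (dom f), h (cod f))) _ _ _ _) => //.
- by move=> x; rewrite dom_idn cod_idn.
- by move=> g f p q; rewrite dom_cmp cod_cmp.
Defined.

Definition to_unit (A : Category) : Functor A (discrete unit) :=
  @to_discrete A unit (fun _ => tt) (fun _ => eq_refl).

Lemma chaotic_iso (T : Type) (f : Ar (chaotic T)) : is_iso f.
Proof. by exists (snd f, fst f), eq_refl, eq_refl. Qed.

Lemma unit_eq (x y : unit) : x = y.
Proof. by case: x; case: y. Qed.

(** The given element serves as the inverse functor; the empty chaotic category is not equivalent to
    the point. *)
Lemma chaotic_equivalence (T : Type) : T -> equivalence (to_unit (chaotic T)).
Proof.
move=> x; exists (@point (chaotic T) x); split; apply/nat_isoP.
- exists (fun y => (y, x)); do 3![split=> //]; first by move=> y; apply: chaotic_iso.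
  by move=> f; exists (fst f, x); split; exists eq_refl.
- exists (fun y => y); split=> [y|]; first exact: unit_eq.
  split=> //; split=> [y|f]; first by exists y, eq_refl, eq_refl.
  by exists tt; split; exists (unit_eq _ _); apply: unit_eq.
Qed.

Lemma chaotic_isofibration (T : Type) : isofibration (to_unit (chaotic T)).
Proof.
move=> x b _ _; exists (x, x); split; first exact: chaotic_iso.
by split=> //; apply: unit_eq.
Qed.

Lemma trivial_weq_hor_map (X Y : DoubleCat) (P : DoubleFunctor X Y) :
  @trivial_weq DblCat_h X Y P -> equivalence (hor_map P).
Proof. by move=> wP; apply: equivalence_retract (hor_map_retract P) (wP _). Qed.

Lemma trivial_fib_hor_map (X Y : DoubleCat) (P : DoubleFunctor X Y) :
  @trivial_fib DblCat_h X Y P -> isofibration (hor_map P).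
Proof. by move=> fP; apply: isofibration_retract (hor_map_retract P) (fP _). Qed.

(** An identity on data, used in place of transport along [hor_horizontal]. *)
Definition from_hor_horizontal (C : Category) : Functor (hor (horizontal C)) C :=
  @Build_Functor (hor (horizontal C)) C (fun x => x) (fun f => f)
    (fun _ => eq_refl) (fun _ => eq_refl) (fun _ => eq_refl)
    (fun g f p q => @cmp_congr C g g f f p q eq_refl eq_refl).

(** [F] and [hor (H F)] have equal components, but different sources and targets. *)
Lemma hor_map_horizontal_retract (A B : Category) (F : Functor A B) :
  @retract_of CAT _ _ _ _ F (hor_map (horizontal_map F)).
Proof.
exists (transpose (dfid (horizontal A))), (from_hor_horizontal A),
  (transpose (dfid (horizontal B))), (from_hor_horizontal B).
by do 3![split; first exact: functor_ext]; exact: functor_ext.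
Qed.

Lemma equivalence_horizontal (A B : Category) (F : Functor A B) :
  equivalence F <->
  @trivial_weq DblCat_h (horizontal A) (horizontal B) (horizontal_map F).
Proof.
split=> [eF E|/trivial_weq_hor_map]; first exact: equivalence_hom_post.
exact: equivalence_retract (hor_map_horizontal_retract F).
Qed.

Lemma isofibration_horizontal (A B : Category) (F : Functor A B) :
  isofibration F <->
  @trivial_fib DblCat_h (horizontal A) (horizontal B) (horizontal_map F).
Proof.
split=> [fF E|/trivial_fib_hor_map]; first exact: isofibration_hom_post.
exact: isofibration_retract (hor_map_horizontal_retract F).
Qed.

Lemma injective_horizontal (A B : Category) (F : Functor A B) :
  injective_on_objects F <->
  @trivial_cof DblCat_h (horizontal A) (horizontal B) (horizontal_map F).
Proof.
split=> [iF X Y P fP wP u v /= sq|cF x y e].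
- have tsq : fcomp (hor_map P) (transpose u) = fcomp (transpose v) F.
    apply: functor_ext => x; first exact: (functor_eq_ob (f_equal (@DF0 _ _) sq) x).
    exact: (functor_eq_ob (f_equal (@DF1 _ _) sq) x).
  have [d [d1 d2]] := injective_lifts iF (trivial_weq_hor_map wP)
    (trivial_fib_hor_map fP) tsq.
  exists (cotranspose d); split; apply: horizontal_dfunctor_ext; apply: functor_ext => x /=.
  + exact: (functor_eq_ob d1 x).
  + exact: (functor_eq_ar d1 x).
  + exact: (functor_eq_ob d2 x).
  + exact: (functor_eq_ar d2 x).
- (* A lift of the identity on objects is a left inverse of [F] on objects. *)
  pose p := to_unit (chaotic (Ob A)).
  have fp := proj1 (isofibration_horizontal p) (@chaotic_isofibration (Ob A)).
  (* The object [x], one of the two to be identified, witnesses that [Ob A] is inhabited. *)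
  have wp := proj1 (equivalence_horizontal p) (chaotic_equivalence x).
  have [|d [d1 _]] := cF _ _ _ fp wp (horizontal_map (to_chaotic (fun z => z)))
    (horizontal_map (to_unit B)).
    by apply: dfunctor_ext; apply: to_discrete_ext => z; apply: unit_eq.
  have dF z : F_ob (DF0 d) (F_ob F z) = z.
    exact: (functor_eq_ob (f_equal (@DF0 _ _) d1) z).
  by rewrite -(dF x) -(dF y) e.
Qed.

Lemma HH_full_embedding : full_embedding HH.
Proof.
split=> [A B /(f_equal hor)|A B g]; first by rewrite /= !hor_horizontal.
(* A double functor into [H B] is determined by its action on objects and horizontal morphisms,
   which the transpose records. *)
exists (fcomp (from_hor_horizontal B) (transpose g)); split=> [|f <-].
  by apply: dfunctor_ext; apply: to_discrete_ext.
exact: functor_ext.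
Qed.

(** The retract argument: factor [f] as a cofibration followed by an acyclic fibration and lift [f]
    against the latter. *)
Lemma cof_lifting (K : TwoCat) (N : ModelStructure (underlying K)) : is_trivial N ->
  forall A B (f : @mor (underlying K) A B), cof N f <-> trivial_cof f.
Proof.
move=> tN A B f; split=> [cf X Y p fp wp|cf].
  by apply: (lift_cof_tfib cf); apply tN.
case: (factor_cof_tfib N f) => C [i [p [e [ci [fp wp]]]]].
have sq : comp1 p i = comp1 (id1 B) f by rewrite e idl1.
have tfp := proj1 (proj2 (tN _ _ p)) fp.
have twp := proj1 (proj1 (tN _ _ p)) wp.
case: (cf _ _ p tfp twp _ _ sq) => d [d1 d2].
(* The lift exhibits [f] as a retract of [i]. *)
apply: (cof_retract (m := N) (g := i)) ci.
exists (id1 A), (id1 A), d, p; rewrite !idl1 !idr1; do 3![split=> //].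
Qed.

Theorem proposition8p54 :
  (forall (A B : Category) (F : Functor A B),
     (equivalence F <-> @trivial_weq DblCat_h (horizontal A) (horizontal B) (horizontal_map F)) /\
     (isofibration F <-> @trivial_fib DblCat_h (horizontal A) (horizontal B) (horizontal_map F)) /\
     (injective_on_objects F <->
        @trivial_cof DblCat_h (horizontal A) (horizontal B) (horizontal_map F))) /\
  full_embedding HH /\
  (forall (M : ModelStructure CAT) (N : ModelStructure (underlying DblCat_h)),
     is_categorical M -> is_trivial N -> extends_along HH M N).
Proof.
have main A B F := conj (@equivalence_horizontal A B F)
  (conj (@isofibration_horizontal A B F) (@injective_horizontal A B F)).
split=> //; split; first exact: HH_full_embedding.
move=> M N cM tN; split; first exact: HH_full_embedding.
move=> A B F; case: (main A B F) => w [f c].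
case: (cM A B F) => Mw [Mf Mc]; case: (tN _ _ (horizontal_map F)) => Nw Nf.
have Nc := cof_lifting tN (horizontal_map F).
by split; [rewrite Mw w -Nw|split; [rewrite Mf f -Nf|rewrite Mc c -Nc]].
Qed.
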